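(* For any given $(X,Y)\in\mathrm{gph}\,\partial\|\cdot\|_*\subseteq\mathbb{R}^{m\times n}\times\mathbb{R}^{m\times n}$ (with $m\le n$), one has $$\widehat{\mathcal{N}}_{\mathrm{gph}\,\partial\|\cdot\|_*}(X,Y)=\mathcal{N}^{\pi}_{\mathrm{gph}\,\partial\|\cdot\|_*}(X,Y).$$
   Context: $\mathbb{R}^{m\times n}$ carries the trace inner product and its induced norm $\|\cdot\|_F$; $\|X\|_*$ is the nuclear norm (sum of singular values), $\partial\|\cdot\|_*$ its convex subdifferential mapping, and $\mathrm{gph}\,\partial\|\cdot\|_*=\{(X,Y): Y\in\partial\|X\|_*\}$. For a set $S$ and $x\in S$: the regular normal cone is $\widehat{\mathcal N}_S(x)=\{v:\langle v,x'-x\rangle\le o(\|x'-x\|)\text{ for }x'\in S,\ x'\to x\}$; the proximal normal cone $\mathcal{N}^{\pi}_S(x)$ is the set of $v$ for which there is $\varepsilon>0$ with $\langle v,x'-x\rangle\le\varepsilon\|x'-x\|^2$ for all $x'\in S$. The product space carries the product inner product and norm. *)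

(* Defs.v *)
From mathcomp Require Import all_boot all_order all_algebra.
From mathcomp Require Import polyrcf.
From mathcomp Require Import all_classical all_reals.

Set Implicit Arguments.
Unset Strict Implicit.
Unset Printing Implicit Defensive.

Import Order.TTheory GRing.Theory Num.Theory.
Local Open Scope ring_scope.
Local Open Scope classical_set_scope.

(* The norm [`|A|] of MathComp-Analysis on matrices is the max-entry norm and
   the one on pairs is the max of the two norms.  Everything below therefore
   uses explicit inner products and the norms they induce. *)

Definition trace_inner (R : realType) (m n : nat) (A B : 'M[R]_(m, n)) : R :=
  \tr (A^T *m B).

Definition prod_inner (R : realType) (V W : Type) (ipV : V -> V -> R)
    (ipW : W -> W -> R) (u v : V * W) : R :=
  ipV u.1 v.1 + ipW u.2 v.2.

Definition inner_norm (R : realType) (V : Type) (ip : V -> V -> R) (v : V) : R :=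
  Num.sqrt (ip v v).

(* [rootsR p] lists the distinct real roots of [p] (for [p != 0]) and [mup a p]
   is the multiplicity of [a], so each root is repeated with its multiplicity. *)
Definition real_roots_mult (R : realType) (p : {poly R}) : seq R :=
  flatten [seq nseq (mup a p) a | a <- rootsR p].

(* Square roots of the eigenvalues of [X *m X^T], with multiplicity.  For
   [m <= n] these are the [m = minn m n] singular values of [X]; for [m > n]
   the list contains [m - n] additional zeros. *)
Definition singular_values (R : realType) (m n : nat) (X : 'M[R]_(m, n)) : seq R :=
  [seq Num.sqrt a | a <- real_roots_mult (char_poly (X *m X^T))].

Definition nuclear_norm (R : realType) (m n : nat) (X : 'M[R]_(m, n)) : R :=
  \sum_(s <- singular_values X) s.

Definition subdifferential (R : realType) (V : zmodType) (ip : V -> V -> R)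
    (f : V -> R) (x : V) : set V :=
  [set y | forall z : V, f x + ip y (z - x) <= f z].

Definition gph (V W : Type) (F : V -> set W) : set (V * W) :=
  [set p | F p.1 p.2].

Definition gph_subdiff_nuclear (R : realType) (m n : nat) :
    set ('M[R]_(m, n) * 'M[R]_(m, n)) :=
  gph (subdifferential (@trace_inner R m n) (@nuclear_norm R m n)).
Arguments gph_subdiff_nuclear : clear implicits.

(* The bound [<v, x' - x> <= o(|x' - x|)] for [x'] in [S], [x'] tending to [x],
   written out with epsilon and delta. *)
Definition regular_normal_cone (R : realType) (V : zmodType) (ip : V -> V -> R)
    (S : set V) (x : V) : set V :=
  [set v | forall e : R, 0 < e -> exists2 d : R, 0 < d &
     forall x' : V, S x' -> inner_norm ip (x' - x) < d ->
       ip v (x' - x) <= e * inner_norm ip (x' - x)].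

Definition proximal_normal_cone (R : realType) (V : zmodType) (ip : V -> V -> R)
    (S : set V) (x : V) : set V :=
  [set v | exists2 e : R, 0 < e &
     forall x' : V, S x' -> ip v (x' - x) <= e * inner_norm ip (x' - x) ^+ 2].

(* Main.v *)
Require Import Defs.
From mathcomp Require Import all_boot all_order all_algebra.
From mathcomp Require Import polyrcf complex.
From mathcomp Require Import all_classical all_reals.
From mathcomp Require Import ring lra.

(* [Y] is a subgradient at [X] iff [I - Y Y^T] is positive semidefinite and [X = A Y] for some
   positive semidefinite [A] with [A (I - Y Y^T) = 0]; equivalently, the matrices
   [[X Y^T, -X], [-X^T, Y^T X]] and [[I, Y], [Y^T, I]] are positive semidefinite with product 0.
   Any complementary pair near a given one [(A0, B0)] becomes, after a congruence [G] close to
   the identity, a pair [(A3, B3)] with [A0 B3 = A3 B0 = A3 B3 = 0], so that the whole chord from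
   [(A0, B0)] to [(A3, B3)] is complementary.  Carrying the chord back along [I + t (G - I)], in
   essence, and renormalising the diagonal blocks to [I] gives, for every graph point [z'] near
   [z] and every [t] in [[0, 1]], a graph point within [C t |z' - z|^2] of [z + t (z' - z)].
   Testing a regular normal [v] on it and letting [t] tend to 0 yields
   [<v, z' - z> <= C' |z' - z|^2], so [v] is a proximal normal. *)

Set Implicit Arguments.
Unset Strict Implicit.
Unset Printing Implicit Defensive.

Import Order.TTheory GRing.Theory Num.Theory.
Local Open Scope ring_scope.

(** * The spectral theorem for real symmetric matrices *)

(** The complexified matrix is Hermitian, hence unitarily diagonalisable with real spectrum. Its
    first diagonal entry is a root of the characteristic polynomial, and this descends along the
    embedding of [R] into [R[i]]. *)
Lemma symmetric_real_eigenvalue (R : rcfType) (n : nat) (A : 'M[R]_n.+1) :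
  A^T = A -> exists a, eigenvalue A a.
Proof.
move=> symA; pose f : {rmorphism R -> R[i]} := real_complex R.
pose AC := map_mx f A.
have hermA : AC \is hermsymmx.
  apply: realsym_hermsym.
    by rewrite qualifE /= expr0 scale1r map_mx_id // map_trmx symA.
  by apply/mxOverP => i j; rewrite mxE complex_real.
have /orthomx_spectralP specA := hermitian_normalmx hermA.
have /mxOverP/(_ 0 0) dreal := hermitian_spectral_diag_real hermA.
have Uu := spectral_unit AC.
set U := spectralmx AC in specA Uu; set d := spectral_diag AC in specA dreal.
have /complex_realP [a da] := dreal.
exists a.
rewrite eigenvalue_root_char -(fmorph_root f) map_char_poly -eigenvalue_root_char.
apply/eigenvalueP; exists (row 0 U).
  have eqUA : U *m AC = diag_mx d *m U by rewrite {1}specA !mulmxA mulmxV // mul1mx.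
  rewrite -/AC -row_mul eqUA; apply/rowP => j.
  by rewrite !mxE (bigD1 0) //= big1 ?addr0 => [|k /negPf k0];
      rewrite !mxE ?eqxx ?da// eq_sym k0 mulr0n mul0r.
apply/eqP => /(congr1 (mulmx^~ (invmx U))); rewrite -row_mul mulmxV // mul0mx => /rowP/(_ 0).
by rewrite !mxE eqxx => /eqP; rewrite oner_eq0.
Qed.

Lemma dotmxx_eq0 (R : realDomainType) (n : nat) (u : 'rV[R]_n) :
  (u *m u^T == 0) = (u == 0).
Proof.
apply/eqP/eqP => [/matrixP/(_ 0 0)|->]; last by rewrite mul0mx.
rewrite !mxE => /eqP; rewrite psumr_eq0 => [/allP u0|i _]; last by rewrite mxE -expr2 sqr_ge0.
apply/rowP => i; rewrite mxE; apply/eqP.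
by have := u0 i (mem_index_enum _); rewrite /= mxE mulf_eq0 orbb.
Qed.

(* The Householder reflection exchanging [u] and the first basis vector. *)
Lemma orthogonal_first_row (R : rcfType) (n : nat) (u : 'rV[R]_n.+1) :
  u *m u^T = 1%:M -> exists Q : 'M[R]_n.+1, [/\ Q *m Q^T = 1%:M, Q^T = Q & row 0 Q = u].
Proof.
move=> u1; pose e : 'rV[R]_n.+1 := delta_mx 0 0.
have [w wE] : exists w, w = u - e by exists (u - e).
have ee : e *m e^T = 1%:M.
  apply/matrixP => i j; rewrite !ord1 !mxE (bigD1 0) //= big1 => [|k k0].
    by rewrite !mxE !eqxx /= mulr1 addr0.
  by rewrite !mxE (negPf k0) andbF mul0r.
have [w0|w0] := eqVneq w 0.
  exists 1%:M; split; rewrite ?trmx1 ?mul1mx //; rewrite row1.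
  by apply/eqP; rewrite eq_sym -subr_eq0 -/e -wE w0.
pose s : R := (w *m w^T) 0 0.
have s0 : s != 0.
  by apply: contra w0 => /eqP s0; rewrite -dotmxx_eq0 [w *m _]mx11_scalar -/s s0 -scalemx1 scale0r.
have wwT : w *m w^T = s%:M by rewrite [LHS]mx11_scalar.
have eu : e *m u^T = u *m e^T.
  have := mx11_scalar (u *m e^T) => E; rewrite -[e *m _]trmxK trmx_mul trmxK E; exact: tr_scalar_mx.
(* As [u] and [e] are unit vectors, [s = 2 - 2 <e, u> = - 2 <e, w>]; so the reflection along [w]
   sends [e] to [e + w = u]. *)
have ew : 2 *: (e *m w^T) = - s%:M.
  rewrite -wwT wE linearB /= mulmxBl !mulmxBr u1 ee eu.
  by apply/matrixP => i j; rewrite !mxE; ring.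
exists (1%:M - (2 / s) *: (w^T *m w)).
have QT : (1%:M - (2 / s) *: (w^T *m w))^T = 1%:M - (2 / s) *: (w^T *m w).
  by rewrite linearB /= trmx1 linearZ /= trmx_mul trmxK.
split=> //.
  have sq : w^T *m w *m (w^T *m w) = s *: (w^T *m w).
    by rewrite mulmxA -[w^T *m w *m w^T]mulmxA wwT mul_mx_scalar scalemxAl.
  rewrite QT mulmxBl !mulmxBr !mul1mx mulmx1 -scalemxAl -scalemxAr sq !scalerA ?mulrA.
  have -> : 2 / s * 2 / s * s = 2 / s + 2 / s by field.
  by rewrite scalerDl opprB addrK subrK.
rewrite rowE -/e mulmxBr mulmx1 -scalemxAr mulmxA scalemxAl.
have -> : (2 / s) *: (e *m w^T) = - 1%:M.
  by rewrite mulrC -scalerA ew scalerN -[s%:M]scalemx1 scalerA mulVf // scale1r.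
by rewrite mulNmx mul1mx opprK wE addrC subrK.
Qed.

(** Deflation: conjugating by a reflection whose first row is a unit eigenvector makes the first row
    of the matrix a multiple of the first basis vector. Symmetry then gives a block diagonal matrix,
    and induction treats the lower block. The eigenvectors are the rows of [Q]. *)
Theorem symmetric_spectral (R : rcfType) (n : nat) (A : 'M[R]_n) :
  A^T = A -> exists (Q : 'M[R]_n) (d : 'rV[R]_n), Q *m Q^T = 1%:M /\ A = Q^T *m diag_mx d *m Q.
Proof.
elim: n A => [|n IHn] A symA.
  by exists 1%:M, 0; split; rewrite [LHS]flatmx0 [RHS]flatmx0.
have [a /eigenvalueP [v vA v0]] := symmetric_real_eigenvalue symA.
pose s : R := (v *m v^T) 0 0.
have s_gt0 : 0 < s.
  rewrite lt_neqAle; apply/andP; split; last first.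
    by rewrite /s mxE sumr_ge0 // => i _; rewrite mxE -expr2 sqr_ge0.
  apply: contra v0 => /eqP s0; rewrite -dotmxx_eq0 [v *m _]mx11_scalar -/s -s0.
  by rewrite -scalemx1 scale0r.
pose u := (Num.sqrt s)^-1 *: v.
have uu : u *m u^T = 1%:M.
  rewrite /u linearZ /= -scalemxAl -scalemxAr scalerA [v *m _]mx11_scalar -/s.
  by rewrite -invfM -expr2 sqr_sqrtr ?ltW // -[s%:M]scalemx1 scalerA mulVf ?scale1r ?gt_eqF.
have uA : u *m A = a *: u by rewrite /u -scalemxAl vA !scalerA mulrC.
have [H [HH HT rH]] := orthogonal_first_row uu.
rewrite HT in HH.
have [B BE] : exists B : 'M_(1 + n), B = H *m A *m H by eexists.
have BT : B^T = B by rewrite BE !trmx_mul HT symA mulmxA.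
have rB : row 0 B = a *: row 0 1%:M.
  by rewrite BE !row_mul rH uA -scalemxAl -rH -row_mul HH.
have [Q [d [QQ dB]]] : exists (Q : 'M[R]_n) (d :
    'rV[R]_n), Q *m Q^T = 1%:M /\ drsubmx B = Q^T *m diag_mx d *m Q.
  by apply: IHn; rewrite trmx_drsub BT.
have eB : B = block_mx a%:M 0 0 (Q^T *m diag_mx d *m Q).
  have ul : ulsubmx B = a%:M.
    apply/matrixP => i j; rewrite !ord1 !mxE.
    have /rowP/(_ 0) := rB; rewrite !mxE eqxx !mulr1n mulr1 => <-.
    by congr (B _ _); apply/val_inj.
  have ur : ursubmx B = 0.
    apply/matrixP => i j; rewrite !ord1 !mxE.
    have /rowP/(_ (rshift 1 j)) := rB; rewrite !mxE /= mulr0n mulr0 => E; rewrite -[RHS]E.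
    by congr (B _ _); apply/val_inj.
  by rewrite -[LHS]submxK ul ur dB -[dlsubmx B]trmxK trmx_dlsub BT ur trmx0.
pose Q1 : 'M_(1 + n) := block_mx 1%:M 0 0 Q.
have HTQ : (Q1 *m H) *m (Q1 *m H)^T = 1%:M.
  rewrite trmx_mul HT mulmxA -[Q1 *m H *m H]mulmxA HH mulmx1 tr_block_mx mulmx_block.
  by rewrite !trmx0 !trmx1 !mulmx0 !mul0mx !mulmx1 !addr0 add0r QQ -scalar_mx_block.
exists (Q1 *m H), (row_mx a%:M d); split=> //.
rewrite trmx_mul HT !mulmxA.
have -> : A = H *m B *m H by rewrite BE !mulmxA HH mul1mx -mulmxA HH mulmx1.
have da : diag_mx a%:M = a%:M :> 'M_1.
  by apply/matrixP => i j; rewrite !ord1 !mxE.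
have DE : diag_mx (row_mx a%:M d) = block_mx a%:M 0 0 (diag_mx d) :> 'M_(1 + n).
  by rewrite diag_mx_row da.
rewrite [diag_mx _]DE -!mulmxA; congr (_ *m _); rewrite !mulmxA; congr (_ *m _).
suff E : B = Q1^T *m block_mx a%:M 0 0 (diag_mx d) *m Q1 by exact: E.
rewrite eB tr_block_mx !mulmx_block !trmx0 !trmx1.
by rewrite !(mulmx0, mul0mx, mulmx1, mul1mx, addr0, add0r).
Qed.

(** * Semidefinite matrices and the subdifferential of the nuclear norm *)

(** Symmetry is demanded explicitly because a real quadratic form does not see the antisymmetric
    part of its matrix. *)
Definition psd (R : realType) (n : nat) (A : 'M[R]_n) : Prop :=
  A^T = A /\ forall x : 'rV_n, 0 <= (x *m A *m x^T) 0 0.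

Lemma psd_congr (R : realType) (m n : nat) (G : 'M[R]_(m, n)) (A : 'M[R]_n) :
  psd A -> psd (G *m A *m G^T).
Proof.
move=> [symA posA]; split; first by rewrite !trmx_mul trmxK symA mulmxA.
by move=> x; have := posA (x *m G); rewrite trmx_mul !mulmxA.
Qed.

Lemma psd_congrT (R : realType) (m n : nat) (G : 'M[R]_(n, m)) (A : 'M[R]_n) :
  psd A -> psd (G^T *m A *m G).
Proof. by move=> /(psd_congr G^T); rewrite trmxK. Qed.

Lemma psdD (R : realType) (n : nat) (A B : 'M[R]_n) : psd A -> psd B -> psd (A + B).
Proof.
move=> [symA posA] [symB posB]; split; first by rewrite linearD /= symA symB.
by move=> x; rewrite mulmxDr mulmxDl mxE addr_ge0.
Qed.

Lemma psdZ (R : realType) (n : nat) (a : R) (A : 'M[R]_n) : 0 <= a -> psd A -> psd (a *: A).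
Proof.
move=> a0 [symA posA]; split; first by rewrite linearZ /= symA.
by move=> x; rewrite -scalemxAr -scalemxAl mxE mulr_ge0.
Qed.

Lemma psd_diag (R : realType) (n : nat) (d : 'rV[R]_n) :
  psd (diag_mx d) <-> forall i, 0 <= d 0 i.
Proof.
have E (x : 'rV[R]_n) : (x *m diag_mx d *m x^T) 0 0 = \sum_i d 0 i * x 0 i ^+ 2.
  by rewrite mul_mx_diag mxE; apply: eq_bigr => i _; rewrite !mxE; ring.
split=> [[_ pos] i|pos]; last first.
  by split=> [|x]; rewrite ?tr_diag_mx // E sumr_ge0 // => i _; rewrite mulr_ge0 ?sqr_ge0.
have := pos (delta_mx 0 i); rewrite E (bigD1 i) //= big1 => [|j /negPf ji].
  by rewrite mxE !eqxx expr1n mulr1 addr0.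
by rewrite mxE ji andbF expr0n mulr0.
Qed.

Lemma psd1 (R : realType) (n : nat) : psd (1%:M : 'M[R]_n).
Proof. by rewrite -diag_const_mx; apply/psd_diag => i; rewrite mxE. Qed.

Lemma psd_mulmx_tr (R : realType) (m n : nat) (X : 'M[R]_(m, n)) : psd (X *m X^T).
Proof. by have := psd_congr X (psd1 R n); rewrite mulmx1. Qed.

Lemma psd_spectral (R : realType) (n : nat) (A : 'M[R]_n) : psd A ->
  exists (Q : 'M[R]_n) (d : 'rV[R]_n), [/\ Q *m Q^T = 1%:M, Q^T *m Q = 1%:M,
    A = Q^T *m diag_mx d *m Q & forall i, 0 <= d 0 i].
Proof.
move=> psdA; have [Q [d [QQ eA]]] := symmetric_spectral psdA.1.
exists Q, d; split=> //; first exact: mulmx1C.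
apply/psd_diag; have := psd_congr Q psdA.
by rewrite eA !mulmxA QQ mul1mx -mulmxA QQ mulmx1.
Qed.

(** * The nuclear norm and its duality with the spectral norm *)

Lemma count_flatten_nseq (T : eqType) (f : T -> nat) (s : seq T) (a : T) : uniq s ->
  count_mem a (flatten [seq nseq (f x) x | x <- s]) = if a \in s then f a else 0%N.
Proof.
elim: s => [//|x s IHs] /= /andP[xs /IHs {}IHs].
rewrite count_cat IHs inE count_nseq /= eq_sym.
by have [->|ax] := eqVneq a x; rewrite ?(negPf xs) ?mul1n ?addn0 // mul0n.
Qed.

Lemma perm_real_roots_mult (R : realType) (s : seq R) :
  perm_eq (real_roots_mult (\prod_(x <- s) ('X - x%:P))) s.
Proof.
set p := \prod_(x <- s) _.
have p0 : p != 0 by rewrite monic_neq0 // monic_prod_XsubC.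
apply/allP => a _ /=; rewrite count_flatten_nseq ?uniq_roots // -roots_on_rootsR //=.
case: ifP => [_|/negbT]; first by rewrite mu_prod_XsubC.
move=> ra; by rewrite -mu_prod_XsubC mupNroot.
Qed.

Lemma char_poly_similar (R : comNzRingType) (n : nat) (P Q A : 'M[R]_n) :
  P *m Q = 1%:M -> char_poly (P *m A *m Q) = char_poly A.
Proof.
move=> PQ; rewrite /char_poly /char_poly_mx.
have PQ' : map_mx polyC P *m map_mx polyC Q = 1%:M by rewrite -map_mxM PQ map_mx1.
have -> : 'X%:M - map_mx polyC (P *m A *m Q) =
    map_mx polyC P *m ('X%:M - map_mx polyC A) *m map_mx polyC Q.
  rewrite mulmxBr mulmxBl !map_mxM /=; congr (_ - _).
  by rewrite mul_mx_scalar -scalemxAl PQ' scalemx1.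
by rewrite !det_mulmx mulrAC -det_mulmx PQ' det1 mul1r.
Qed.

(** Replaces root lists by any orthogonal diagonalisation of [X X^T]; every nuclear norm below is
    computed in this way. *)
Lemma nuclear_norm_diag (R : realType) (m n : nat) (X : 'M[R]_(m, n)) (Q : 'M[R]_m)
    (d : 'rV[R]_m) :
  Q *m Q^T = 1%:M -> X *m X^T = Q^T *m diag_mx d *m Q ->
  nuclear_norm X = \sum_i Num.sqrt (d 0 i).
Proof.
move=> QQ XX; have QQ' := mulmx1C QQ.
have -> : nuclear_norm X = \sum_(s <- [seq Num.sqrt a | a <- [seq d 0 i | i <- enum 'I_m]]) s.
  rewrite /nuclear_norm; apply: perm_big; apply: perm_map.
  rewrite XX char_poly_similar // char_poly_trig ?diag_mx_is_trig //.
  rewrite (_ : \prod_(i < m) _ = \prod_(x <- [seq d 0 i | i <- enum 'I_m]) ('X - x%:P)).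
    exact: perm_real_roots_mult.
  by rewrite big_map big_enum; apply: eq_bigr => i _; rewrite mxE eqxx.
by rewrite 2!big_map -big_enum.
Qed.

Lemma trace_innerE (R : realType) (m n : nat) (A B : 'M[R]_(m, n)) :
  trace_inner A B = \tr (A *m B^T).
Proof. by rewrite /trace_inner -mxtrace_tr trmx_mul trmxK mxtrace_mulC. Qed.

Lemma psd_diagE (R : realType) (n : nat) (A : 'M[R]_n) (i : 'I_n) : psd A -> 0 <= A i i.
Proof.
by move=> [_ /(_ (delta_mx 0 i))]; rewrite -rowE trmx_delta -colE !mxE.
Qed.

(** Cauchy-Schwarz in the unit ball, with its equality case. Both come from expanding [|x - r y|^2]
    with [r = sqrt d]: it is nonnegative, and at most 0 once [<x, y>] reaches [r]. *)
Lemma dot_le_sqrt (R : realType) (n : nat) (x y : 'rV[R]_n) (d : R) :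
  (x *m x^T) 0 0 = d -> (y *m y^T) 0 0 <= 1 ->
  (x *m y^T) 0 0 <= Num.sqrt d /\
  (Num.sqrt d <= (x *m y^T) 0 0 -> x = Num.sqrt d *: y).
Proof.
move=> xx yy.
have d0 : 0 <= d by rewrite -xx psd_diagE //; apply: psd_mulmx_tr.
set r := Num.sqrt d; have r0 : 0 <= r := sqrtr_ge0 d.
have rr : r ^+ 2 = d := sqr_sqrtr d0.
have E : ((x - r *: y) *m (x - r *: y)^T) 0 0 =
    d - 2 * r * (x *m y^T) 0 0 + r ^+ 2 * (y *m y^T) 0 0.
  have yx : (y *m x^T) 0 0 = (x *m y^T) 0 0.
    by rewrite -[x in RHS]trmxK -trmx_mul [RHS]mxE.
  rewrite [(x - r *: y)^T]linearB /= [(r *: y)^T]linearZ /= mulmxBl !mulmxBr -!scalemxAl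
      -!scalemxAr.
  move: xx yx; move: (x *m x^T) (x *m y^T) (y *m x^T) (y *m y^T) => a b c e.
  by move=> E1 E2; rewrite !mxE E1 E2; ring.
have ge0 : 0 <= ((x - r *: y) *m (x - r *: y)^T) 0 0 by rewrite psd_diagE //; apply: psd_mulmx_tr.
split=> [|le_r].
  have [r_eq0|r_neq0] := eqVneq r 0.
    have x0 : x = 0.
      apply/eqP; rewrite -dotmxx_eq0 [x *m _]mx11_scalar xx -rr r_eq0 expr0n /=.
      by apply/eqP/matrixP => i j; rewrite !mxE mul0rn.
    by rewrite x0 mul0mx mxE.
  have r_gt0 : 0 < r by rewrite lt_neqAle eq_sym r_neq0.
  rewrite -(ler_pM2l r_gt0); nra.
have : ((x - r *: y) *m (x - r *: y)^T) 0 0 = 0.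
  apply/eqP; rewrite eq_le ge0 andbT E; nra.
move=> z0; apply/eqP; rewrite -subr_eq0 -dotmxx_eq0 [_ *m _]mx11_scalar z0.
by apply/eqP/matrixP => i j; rewrite !mxE mul0rn.
Qed.

(** In an eigenbasis [Q] of [X X^T], the rows of [Q X] have squared lengths [d 0 i] and those of
    [Q Y] have length at most 1, so Cauchy-Schwarz applies row by row. Equality forces each row of
    [Q X] to be [sqrt (d 0 i)] times that of [Q Y], which gives [X = A Y] with [A] the square root
    of [X X^T]. *)
Lemma trace_inner_le_nuclear (R : realType) (m n : nat) (X Y : 'M[R]_(m, n)) :
  psd (1%:M - Y *m Y^T) ->
  trace_inner X Y <= nuclear_norm X /\
  (nuclear_norm X <= trace_inner X Y -> exists A, [/\ psd A, X = A *m Y & X *m X^T = A *m A]).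
Proof.
move=> Y1.
have [Q [d [QQ QQ' XX d0]]] := psd_spectral (psd_mulmx_tr X).
rewrite (nuclear_norm_diag QQ XX) trace_innerE.
have row_dot (U V : 'M[R]_(m, n)) i : (row i U *m (row i V)^T) 0 0 = (U *m V^T) i i.
  by rewrite !mxE; apply: eq_bigr => j _; rewrite !mxE.
have -> : \tr (X *m Y^T) = \sum_i (row i (Q *m X) *m (row i (Q *m Y))^T) 0 0.
  transitivity (\tr (Q *m X *m (Q *m Y)^T)).
    by rewrite trmx_mul mulmxA [RHS]mxtrace_mulC !mulmxA QQ' mul1mx.
  by apply: eq_bigr => i _; rewrite row_dot.
have xx i : (row i (Q *m X) *m (row i (Q *m X))^T) 0 0 = d 0 i.
  rewrite row_dot trmx_mul mulmxA -[Q *m X *m X^T]mulmxA XX !mulmxA QQ mul1mx -mulmxA QQ mulmx1.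
  by rewrite mxE eqxx.
have yy i : (row i (Q *m Y) *m (row i (Q *m Y))^T) 0 0 <= 1.
  rewrite row_dot; have /psd_diagE := psd_congr Q Y1 => /(_ i).
  rewrite mulmxBr mulmxBl mulmx1 QQ trmx_mul !mulmxA mxE [1%:M i i]mxE eqxx mxE subr_ge0.
  done.
have le i := (dot_le_sqrt (xx i) (yy i)).1.
split=> [|ge]; first by apply: ler_sum => i _; apply: le.
set D := diag_mx (map_mx Num.sqrt d).
have DD : D *m D = diag_mx d.
  rewrite mul_diag_mx; apply/matrixP => i j; rewrite !mxE.
  by case: eqP => [->|_]; rewrite ?mulr0n ?mulr0 // !mulr1n -expr2 sqr_sqrtr.
exists (Q^T *m D *m Q); split; last first.
- by rewrite XX !mulmxA -[_ *m Q *m Q^T]mulmxA QQ mulmx1 -[Q^T *m D *m D]mulmxA DD.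
- suff E : Q *m X = D *m (Q *m Y) by rewrite -[LHS]mul1mx -QQ' -!mulmxA E.
  apply/row_matrixP => i.
  have -> : row i (D *m (Q *m Y)) = Num.sqrt (d 0 i) *: row i (Q *m Y).
    by apply/rowP => j; rewrite mul_diag_mx !mxE.
  apply: (dot_le_sqrt (xx i) (yy i)).2.
  (* The rowwise gaps are nonnegative and their sum is at most 0, so each of them vanishes. *)
  set g := fun j => Num.sqrt (d 0 j) - (row j (Q *m X) *m (row j (Q *m Y))^T) 0 0.
  have g0 j : true -> 0 <= g j by rewrite subr_ge0 le.
  have sum0 : \sum_j g j = 0 by apply/eqP; rewrite eq_le sumr_ge0 // andbT sumrB subr_le0.
  by have /eqP := psumr_eq0P g0 sum0 (i := i) isT; rewrite subr_eq0 => /eqP ->.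
by apply: psd_congrT; apply/psd_diag => i; rewrite mxE sqrtr_ge0.
Qed.

Lemma mulmx_tr_eq0 (R : realType) (m n : nat) (M : 'M[R]_(m, n)) : M *m M^T = 0 -> M = 0.
Proof.
move=> MM; apply/row_matrixP => i; rewrite row0; apply/eqP; rewrite -dotmxx_eq0; apply/eqP.
have /matrixP/(_ i i) := MM; rewrite !mxE => E; apply/matrixP => j k.
by rewrite !ord1 !mxE -[RHS]E; apply: eq_bigr => l _; rewrite !mxE.
Qed.

Lemma psd_factor (R : realType) (n : nat) (A : 'M[R]_n) : psd A -> exists F : 'M[R]_n, A = F *m F^T.
Proof.
move=> /psd_spectral [Q [d [QQ QQ' -> d0]]].
exists (Q^T *m diag_mx (map_mx Num.sqrt d)).
rewrite trmx_mul trmxK tr_diag_mx mulmxA -[_ *m diag_mx _ *m diag_mx _]mulmxA; congr (_ *m _ *m _).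
rewrite mul_diag_mx; apply/matrixP => i j; rewrite !mxE.
by case: eqP => [->|_]; rewrite ?mulr0n ?mulr0 // !mulr1n -expr2 sqr_sqrtr.
Qed.

(** With [C = F F^T] the hypothesis reads [(A F) (A F)^T = 0], so [A F = 0]. *)
Lemma psd_sandwich_eq0 (R : realType) (m n : nat) (A : 'M[R]_(m, n)) (C : 'M[R]_n) :
  psd C -> A *m C *m A^T = 0 -> A *m C = 0.
Proof.
move=> /psd_factor [F ->] ACA.
suff -> : A *m (F *m F^T) = A *m F *m F^T by rewrite (@mulmx_tr_eq0 _ _ _ (A *m F)) ?mul0mx //
    trmx_mul -ACA !mulmxA.
by rewrite mulmxA.
Qed.

Lemma nuclear_norm0 (R : realType) (m n : nat) : nuclear_norm (0 : 'M[R]_(m, n)) = 0.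
Proof.
rewrite (@nuclear_norm_diag _ _ _ _ 1%:M 0).
- by rewrite big1 // => i _; rewrite mxE sqrtr0.
- by rewrite trmx1 mulmx1.
- by rewrite mul0mx [diag_mx 0]linear0 mulmx0 mul0mx.
Qed.

(* Testing the inequality on large multiples of [q q^T Y], for a unit eigenvector [q] of [Y Y^T]
   with eigenvalue [e], gives [e <= sqrt e]. *)
Lemma subgradient_spectral_norm (R : realType) (m n : nat) (Y : 'M[R]_(m, n)) (c : R) :
  (forall Z : 'M[R]_(m, n), trace_inner Y Z <= nuclear_norm Z + c) ->
  psd (1%:M - Y *m Y^T).
Proof.
move=> leY; have [Q [e [QQ QQ' YY e0]]] := psd_spectral (psd_mulmx_tr Y).
suff e1 i : e 0 i <= 1.
  have -> : 1%:M - Y *m Y^T = Q^T *m diag_mx (const_mx 1 - e) *m Q.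
    by rewrite linearB /= diag_const_mx mulmxBr mulmxBl mulmx1 QQ' YY.
  by apply: psd_congrT; apply/psd_diag => i; rewrite !mxE subr_ge0.
pose D := diag_mx (delta_mx 0 i : 'rV[R]_m).
have DT : D^T = D by rewrite tr_diag_mx.
have QYY : Q *m Y *m (Q *m Y)^T = diag_mx e.
  by rewrite trmx_mul mulmxA -[Q *m Y *m Y^T]mulmxA YY !mulmxA QQ mul1mx -mulmxA QQ mulmx1.
pose Z s := s *: (Q^T *m D *m (Q *m Y)).
have normZ s : 0 <= s -> nuclear_norm (Z s) = s * Num.sqrt (e 0 i).
  (* In the basis [Q], the matrix [Z Z^T] is diagonal with single possibly nonzero entry
     [s^2 e_i]. *)
  move=> s0; rewrite (@nuclear_norm_diag _ _ _ _ Q (s ^+ 2 *: (\row_j (e 0 j *+ (j == i))))) //.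
    rewrite (bigD1 i) //= big1 => [|j /negPf ji]; last by rewrite !mxE ji mulr0n mulr0 sqrtr0.
    by rewrite !mxE eqxx mulr1n sqrtrM ?sqr_ge0 // sqrtr_sqr ger0_norm // addr0.
  rewrite /Z linearZ /= -scalemxAl -scalemxAr scalerA -expr2 linearZ /= -scalemxAr -scalemxAl.
  congr (_ *: _); rewrite !trmx_mul trmxK -!mulmxA; congr (_ *m _); rewrite !mulmxA; congr (_ *m _).
  rewrite -[D *m Q *m Y]mulmxA -[_ *m Y^T *m Q^T]mulmxA -trmx_mul -[_ *m _ *m (Q *m Y)^T]mulmxA
      QYY DT.
  rewrite mul_diag_mx mul_mx_diag; apply/matrixP => j k; rewrite !mxE /=.
  have [->|jk] := eqVneq j k; last by rewrite !mulr0n !(mulr0, mul0r).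
  by case: (k == i); rewrite ?mulr0n ?mulr1n ?(mulr1, mul1r, mulr0).
have innerZ s : trace_inner Y (Z s) = s * e 0 i.
  rewrite /Z trace_innerE linearZ /= -scalemxAr linearZ /=; congr (_ * _).
  rewrite !trmx_mul trmxK !mulmxA mxtrace_mulC !mulmxA.
  rewrite -[Q *m Y *m Y^T *m Q^T]mulmxA -trmx_mul QYY DT mul_diag_mx /mxtrace.
  rewrite (bigD1 i) //= big1 => [|j /negPf ji]; rewrite !mxE.
    by rewrite !eqxx mulr1 addr0.
  by rewrite eqxx ji andbF mul0rn mulr0.
have es : e 0 i <= Num.sqrt (e 0 i).
  (* A positive gap [g = e_i - sqrt e_i] would be contradicted at [s = (c + 1) / g], where the
     hypothesis says [s g <= c]. Testing at 0 gives [c >= 0], which makes this [s] nonnegative. *)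
  rewrite leNgt; apply/negP; rewrite -subr_gt0; set g := _ - _ => g0.
  have c0 : 0 <= c by have := leY 0; rewrite nuclear_norm0 trace_innerE trmx0 mulmx0 linear0 add0r.
  have s0 : 0 <= (c + 1) / g by rewrite divr_ge0 ?ltW // ltr_wpDl.
  have := leY (Z ((c + 1) / g)); rewrite innerZ normZ //.
  have : (c + 1) / g * g = c + 1 by rewrite divfK ?gt_eqF.
  rewrite {2}/g mulrBr; lra.
have := sqr_sqrtr (e0 i); have := sqrtr_ge0 (e 0 i); nra.
Qed.

(** Forward: the subgradient inequality bounds the spectral norm of [Y], and its instance at 0 is
    the equality case of duality, which yields [A] with [A A = X X^T]; then
    [A (I - Y Y^T) A = A A - X X^T = 0]. Backward: [A Y Y^T = A] gives [X X^T = A A], so the nuclear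
    norm of [X] is the trace of [A], that is [<X, Y>], and duality at [Z] concludes. *)
Lemma gph_subdiff_nuclearP (R : realType) (m n : nat) (X Y : 'M[R]_(m, n)) :
  gph_subdiff_nuclear R m n (X, Y) <->
  exists A, [/\ psd A, psd (1%:M - Y *m Y^T), X = A *m Y & A *m (1%:M - Y *m Y^T) = 0].
Proof.
have innerC (U V : 'M[R]_(m, n)) : trace_inner U V = trace_inner V U.
  by rewrite trace_innerE -mxtrace_tr trmx_mul trmxK -trace_innerE.
have innerB (U V W : 'M[R]_(m, n)) : trace_inner U (V - W) = trace_inner U V - trace_inner U W.
  by rewrite !trace_innerE linearB /= mulmxBr linearB.
split=> [gXY|[A [psdA Y1 XE AY]] Z /=].
  have Y1 : psd (1%:M - Y *m Y^T).
    apply: (@subgradient_spectral_norm _ _ _ _ (trace_inner Y X - nuclear_norm X)) => Z.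
    have := gXY Z; rewrite /= innerB; lra.
  have [_] := trace_inner_le_nuclear X Y1.
  have := gXY 0; rewrite /= sub0r nuclear_norm0 -sub0r innerB innerC.
  rewrite {1}/trace_inner trmx0 mul0mx linear0 innerC => ge0 [|A [psdA XE AA]]; first by lra.
  exists A; split=> //; apply: psd_sandwich_eq0 => //.
  by rewrite psdA.1 mulmxBr mulmxBl mulmx1 -AA XE trmx_mul psdA.1 !mulmxA subrr.
have AYY : A *m Y *m Y^T = A
    by apply/eqP; rewrite eq_sym -subr_eq0 -mulmxA -{1}[A]mulmx1 -mulmxBr AY.
have := (trace_inner_le_nuclear Z Y1).1.
have : nuclear_norm X <= trace_inner X Y.
  have [Q [d [QQ QQ' eA d0]]] := psd_spectral psdA.
  have XX : X *m X^T = Q^T *m diag_mx (\row_i d 0 i ^+ 2) *m Q.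
    rewrite XE trmx_mul psdA.1 mulmxA AYY eA !mulmxA -[_ *m Q *m Q^T]mulmxA QQ mulmx1.
    rewrite -[_ *m diag_mx d *m diag_mx d]mulmxA; congr (_ *m _ *m _).
    rewrite mul_diag_mx; apply/matrixP => i j; rewrite !mxE.
    by case: eqP => [->|_]; rewrite ?mulr0n ?mulr0 // !mulr1n expr2.
  rewrite (nuclear_norm_diag QQ XX) trace_innerE XE AYY eA mxtrace_mulC mulmxA QQ mul1mx.
  rewrite mxtrace_diag ler_sum // => i _.
  by rewrite mxE sqrtr_sqr ger0_norm.
rewrite innerB [trace_inner Y X]innerC [trace_inner Y Z]innerC; lra.
Qed.

(** * Families following a chord up to quadratic errors *)

(** The entrywise l1 norm is submultiplicative, invariant under transposition and additive over
    blocks, which keeps the estimates free of square roots. It is compared with the Frobenius norm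
    only when the normal cones come in. *)
Definition mnorm (R : realType) (m n : nat) (A : 'M[R]_(m, n)) : R :=
  \sum_i \sum_j `|A i j|.

Lemma mnorm_ge0 (R : realType) (m n : nat) (A : 'M[R]_(m, n)) : 0 <= mnorm A.
Proof. by rewrite !sumr_ge0 // => i _; rewrite sumr_ge0. Qed.

Lemma mnorm_tr (R : realType) (m n : nat) (A : 'M[R]_(m, n)) : mnorm A^T = mnorm A.
Proof.
by rewrite /mnorm exchange_big; apply: eq_bigr => i _; apply: eq_bigr => j _; rewrite mxE.
Qed.

Lemma mnormD (R : realType) (m n : nat) (A B : 'M[R]_(m, n)) : mnorm (A + B) <= mnorm A + mnorm B.
Proof.
rewrite /mnorm -big_split ler_sum // => i _; rewrite -big_split ler_sum // => j _.
by rewrite mxE ler_normD.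
Qed.

Lemma mnormZ (R : realType) (m n : nat) (a : R) (A : 'M[R]_(m, n)) :
  mnorm (a *: A) = `|a| * mnorm A.
Proof.
rewrite /mnorm mulr_sumr; apply: eq_bigr => i _; rewrite mulr_sumr; apply: eq_bigr => j _.
by rewrite mxE normrM.
Qed.

Lemma mnormN (R : realType) (m n : nat) (A : 'M[R]_(m, n)) : mnorm (- A) = mnorm A.
Proof. by rewrite -scaleN1r mnormZ normrN1 mul1r. Qed.

Lemma mnorm0 (R : realType) (m n : nat) : mnorm (0 : 'M[R]_(m, n)) = 0.
Proof. by rewrite -(scale0r 0) mnormZ normr0 mul0r. Qed.

Lemma mnorm_entry (R : realType) (m n : nat) (A : 'M[R]_(m, n)) i j : `|A i j| <= mnorm A.
Proof.
rewrite /mnorm (bigD1 i) //= (bigD1 j) //= -addrA lerDl addr_ge0 ?sumr_ge0 // => k _.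
by rewrite sumr_ge0.
Qed.

Lemma mnorm_eq0 (R : realType) (m n : nat) (A : 'M[R]_(m, n)) : mnorm A <= 0 -> A = 0.
Proof.
move=> A0; apply/matrixP => i j; rewrite mxE; apply/eqP; rewrite -normr_le0.
exact: le_trans (mnorm_entry A i j) A0.
Qed.

Lemma mnormM (R : realType) (m n p : nat) (A : 'M[R]_(m, n)) (B : 'M[R]_(n, p)) :
  mnorm (A *m B) <= mnorm A * mnorm B.
Proof.
have rowB k : \sum_j `|B k j| <= mnorm B.
  by rewrite [leRHS](bigD1 k) //= lerDl sumr_ge0 // => i _; rewrite sumr_ge0.
rewrite {1 2}/mnorm mulr_suml ler_sum // => i _; rewrite mulr_suml.
apply: (@le_trans _ _ (\sum_j \sum_k `|A i k| * `|B k j|)).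
  apply: ler_sum => j _; rewrite mxE (le_trans (ler_norm_sum _ _ _)) //.
  by apply: ler_sum => k _; rewrite normrM.
rewrite exchange_big /=; apply: ler_sum => k _; rewrite -mulr_sumr.
by rewrite ler_wpM2l.
Qed.

Lemma mnorm_block (R : realType) (m1 m2 n1 n2 : nat) (A : 'M[R]_(m1, n1)) (B : 'M[R]_(m1, n2))
    (C : 'M[R]_(m2, n1)) (D : 'M[R]_(m2, n2)) :
  mnorm (block_mx A B C D) = mnorm A + mnorm B + (mnorm C + mnorm D).
Proof.
rewrite /mnorm big_split_ord /= -!big_split /=.
congr (_ + _); apply: eq_bigr => i _; rewrite big_split_ord /=;
  congr (_ + _); apply: eq_bigr => j _;
  by rewrite ?(block_mxEul, block_mxEur, block_mxEdl, block_mxEdr).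
Qed.

Lemma mnorm_ulsubmx (R : realType) (m1 m2 n1 n2 : nat) (A : 'M[R]_(m1 + m2, n1 + n2)) :
  mnorm (ulsubmx A) <= mnorm A.
Proof. by rewrite -{2}[A]submxK mnorm_block -addrA lerDl !addr_ge0 // mnorm_ge0. Qed.

Lemma mnorm_ursubmx (R : realType) (m1 m2 n1 n2 : nat) (A : 'M[R]_(m1 + m2, n1 + n2)) :
  mnorm (ursubmx A) <= mnorm A.
Proof. by rewrite -{2}[A]submxK mnorm_block addrAC lerDr !addr_ge0 // mnorm_ge0. Qed.

Lemma mnorm_drsubmx (R : realType) (m1 m2 n1 n2 : nat) (A : 'M[R]_(m1 + m2, n1 + n2)) :
  mnorm (drsubmx A) <= mnorm A.
Proof. by rewrite -{2}[A]submxK mnorm_block addrA lerDr !addr_ge0 // mnorm_ge0. Qed.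

Lemma mnorm_trace (R : realType) (n : nat) (A : 'M[R]_n) : `|\tr A| <= mnorm A.
Proof.
rewrite (le_trans (ler_norm_sum _ _ _)) // ler_sum // => i _.
by rewrite (bigD1 i) //= lerDl sumr_ge0.
Qed.

(** A left kernel matrix [K] satisfies [K = - K (A - I)], so its norm is at most half of itself.
    Likewise the inverse satisfies [V = I - V (A - I)], and half of its norm is absorbed. *)
Lemma mnorm_near1_unit (R : realType) (n : nat) (A : 'M[R]_n) : mnorm (A - 1%:M) <= 1 / 2 ->
  A \in unitmx /\ mnorm (invmx A) <= 2 * mnorm (1%:M : 'M[R]_n).
Proof.
move=> A1.
have Au : A \in unitmx.
  rewrite -row_free_unit -kermx_eq0; apply/eqP/mnorm_eq0.
  set K := kermx A; have KA : K *m A = 0 by apply/sub_kermxP.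
  have KE : K = - (K *m (A - 1%:M)) by rewrite mulmxBr KA mulmx1 sub0r opprK.
  have : mnorm K <= mnorm K * mnorm (A - 1%:M) by rewrite {1}KE mnormN mnormM.
  have := mnorm_ge0 K; nra.
split=> //; set V := invmx A.
have VE : V = 1%:M + - (V *m (A - 1%:M)) by rewrite mulmxBr mulVmx // mulmx1 opprB addrC subrK.
have : mnorm V <= mnorm (1%:M : 'M[R]_n) + mnorm V * mnorm (A - 1%:M).
  by rewrite {1}VE (le_trans (mnormD _ _)) // mnormN lerD2l mnormM.
have := mnorm_ge0 V; nra.
Qed.

(* [e] plays the role of a distance: [u = O(g)] as [e] tends to 0, uniformly over [I]. *)
Definition bigO (R : realType) (I : Type) (e g : I -> R) (m n : nat)
    (u : I -> 'M[R]_(m, n)) : Prop :=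
  exists C d, [/\ 0 <= C, 0 < d & forall i, e i <= d -> mnorm (u i) <= C * g i].

Lemma bigO_eq (R : realType) (I : Type) (e g : I -> R) (m n : nat)
    (u v : I -> 'M[R]_(m, n)) (d : R) :
  0 < d -> (forall i, e i <= d -> u i = v i) -> bigO e g u -> bigO e g v.
Proof.
move=> d0 uv [C [d' [C0 d'0 uC]]]; exists C, (Num.min d d'); split=> //; first by rewrite lt_min d0.
by move=> i; rewrite le_min => /andP[ed ed']; rewrite -uv // uC.
Qed.

Lemma bigO_le (R : realType) (I : Type) (e g : I -> R) (m n p q : nat)
    (u : I -> 'M[R]_(m, n)) (v : I -> 'M[R]_(p, q)) :
  (forall i, mnorm (v i) <= mnorm (u i)) -> bigO e g u -> bigO e g v.
Proof.
move=> vu [C [d [C0 d0 uC]]]; exists C, d; split=> // i ed.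
exact: le_trans (vu i) (uC i ed).
Qed.

(** The comparison is asked only where [e <= 1], the range in which bounds such as [t e^2 <= e]
    hold. *)
Lemma bigO_weaken (R : realType) (I : Type) (e g h : I -> R) (m n : nat) (u : I -> 'M[R]_(m, n)) :
  (forall i, e i <= 1 -> g i <= h i) -> bigO e g u -> bigO e h u.
Proof.
move=> gh [C [d [C0 d0 uC]]]; exists C, (Num.min d 1); split=> //; first by rewrite lt_min d0 ltr01.
move=> i; rewrite le_min => /andP[ed e1]; rewrite (le_trans (uC i ed)) //.
by rewrite ler_wpM2l // gh.
Qed.

Lemma bigO_cst (R : realType) (I : Type) (e : I -> R) (m n : nat) (A : 'M[R]_(m, n)) :
  bigO e (fun=> 1) (fun=> A).
Proof. by exists (mnorm A), 1; split=> [||i _]; rewrite ?mnorm_ge0 ?mulr1. Qed.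

Lemma bigOD (R : realType) (I : Type) (e g : I -> R) (m n : nat) (u v : I -> 'M[R]_(m, n)) :
  bigO e g u -> bigO e g v -> bigO e g (fun i => u i + v i).
Proof.
move=> [C [d [C0 d0 uC]]] [C' [d' [C'0 d'0 vC]]]; exists (C + C'), (Num.min d d'); split.
- exact: addr_ge0.
- by rewrite lt_min d0.
move=> i; rewrite le_min => /andP[ed ed']; rewrite (le_trans (mnormD _ _)) // mulrDl.
by rewrite lerD ?uC ?vC.
Qed.

Lemma bigON (R : realType) (I : Type) (e g : I -> R) (m n : nat) (u : I -> 'M[R]_(m, n)) :
  bigO e g u -> bigO e g (fun i => - u i).
Proof. by apply: bigO_le => i; rewrite mnormN. Qed.

Lemma bigO_tr (R : realType) (I : Type) (e g : I -> R) (m n : nat) (u : I -> 'M[R]_(m, n)) :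
  bigO e g u -> bigO e g (fun i => (u i)^T).
Proof. by apply: bigO_le => i; rewrite mnorm_tr. Qed.

Lemma bigOM (R : realType) (I : Type) (e g h : I -> R) (m n p : nat)
    (u : I -> 'M[R]_(m, n)) (v : I -> 'M[R]_(n, p)) :
  bigO e g u -> bigO e h v -> bigO e (fun i => g i * h i) (fun i => u i *m v i).
Proof.
move=> [C [d [C0 d0 uC]]] [C' [d' [C'0 d'0 vC]]]; exists (C * C'), (Num.min d d'); split.
- exact: mulr_ge0.
- by rewrite lt_min d0.
move=> i; rewrite le_min => /andP[ed ed']; rewrite (le_trans (mnormM _ _)) // mulrACA.
by rewrite ler_pM ?mnorm_ge0 ?uC ?vC.
Qed.

Lemma bigOMl (R : realType) (I : Type) (e g : I -> R) (m n p : nat)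
    (u : I -> 'M[R]_(m, n)) (v : I -> 'M[R]_(n, p)) :
  bigO e (fun=> 1) u -> bigO e g v -> bigO e g (fun i => u i *m v i).
Proof. by move=> u1 vg; apply: bigO_weaken (bigOM u1 vg) => i _; rewrite mul1r. Qed.

Lemma bigOMr (R : realType) (I : Type) (e g : I -> R) (m n p : nat)
    (u : I -> 'M[R]_(m, n)) (v : I -> 'M[R]_(n, p)) :
  bigO e g u -> bigO e (fun=> 1) v -> bigO e g (fun i => u i *m v i).
Proof. by move=> ug v1; apply: bigO_weaken (bigOM ug v1) => i _; rewrite mulr1. Qed.

Lemma bigOZ (R : realType) (I : Type) (e g s : I -> R) (m n : nat) (u : I -> 'M[R]_(m, n)) :
  bigO e g u -> bigO e (fun i => `|s i| * g i) (fun i => s i *: u i).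
Proof.
move=> [C [d [C0 d0 uC]]]; exists C, d; split=> // i ed.
by rewrite mnormZ mulrCA ler_wpM2l // uC.
Qed.

Lemma bigO_block (R : realType) (I : Type) (e g : I -> R) (m1 m2 n1 n2 : nat)
    (u : I -> 'M[R]_(m1, n1)) (v : I -> 'M[R]_(m1, n2))
    (w : I -> 'M[R]_(m2, n1)) (x : I -> 'M[R]_(m2, n2)) :
  bigO e g u -> bigO e g v -> bigO e g w -> bigO e g x ->
  bigO e g (fun i => block_mx (u i) (v i) (w i) (x i)).
Proof.
have ul : bigO e g u -> bigO e g (fun i => block_mx (u i) 0 0 (0 : 'M[R]_(m2, n2))).
  by apply: bigO_le => i; rewrite mnorm_block !mnorm0 !addr0.
have ur : bigO e g v -> bigO e g (fun i => block_mx 0 (v i) (0 : 'M[R]_(m2, n1)) 0).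
  by apply: bigO_le => i; rewrite mnorm_block !mnorm0 !addr0 add0r.
have dl : bigO e g w -> bigO e g (fun i => block_mx 0 (0 : 'M[R]_(m1, n2)) (w i) 0).
  by apply: bigO_le => i; rewrite mnorm_block !mnorm0 !add0r addr0.
have dr : bigO e g x -> bigO e g (fun i => block_mx (0 : 'M[R]_(m1, n1)) 0 0 (x i)).
  by apply: bigO_le => i; rewrite mnorm_block !mnorm0 !add0r.
move=> /ul Hu /ur Hv /dl Hw /dr Hx.
apply: (bigO_eq (d := 1)) (bigOD (bigOD Hu Hv) (bigOD Hw Hx)) => // i _.
by rewrite !add_block_mx !(addr0, add0r).
Qed.

Lemma bigO_small (R : realType) (I : Type) (e : I -> R) (m n : nat) (u : I -> 'M[R]_(m, n)) (b :
    R) :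
  0 < b -> bigO e e u -> exists2 d, 0 < d & forall i, e i <= d -> mnorm (u i) <= b.
Proof.
move=> b0 [C [d [C0 d0 uC]]]; have C1 : 0 < C + 1 by rewrite ltr_wpDl.
exists (Num.min d (b / (C + 1))); first by rewrite lt_min d0 divr_gt0.
move=> i; rewrite le_min => /andP[ed]; rewrite ler_pdivlMr // => eb.
have := uC i ed; have := mnorm_ge0 (u i); nra.
Qed.

Lemma bigO_near1_inv (R : realType) (I : Type) (e : I -> R) (n : nat) (u : I -> 'M[R]_n) :
  bigO e e (fun i => u i - 1%:M) ->
  (exists2 d, 0 < d & forall i, e i <= d -> u i \in unitmx) /\
  bigO e (fun=> 1) (fun i => invmx (u i)).
Proof.
have half : 0 < 1 / 2 :> R by lra.
move=> /(bigO_small half) [d d0 ud].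
split; first by exists d => // i /ud /mnorm_near1_unit[].
exists (2 * mnorm (1%:M : 'M[R]_n)), d; split=> //; first by rewrite mulr_ge0 ?mnorm_ge0.
by move=> i /ud /mnorm_near1_unit[]; rewrite mulr1.
Qed.

(* [ut i] follows the chord from [u0] to [u1 i] at time [t i], up to an error small compared with
   [t i] and quadratic in the distance [e i]. *)
Definition chordal (R : realType) (I : Type) (e t : I -> R) (m n : nat)
    (u0 : 'M[R]_(m, n)) (u1 ut : I -> 'M[R]_(m, n)) : Prop :=
  bigO e e (fun i => u1 i - u0) /\
  bigO e (fun i => t i * e i ^+ 2) (fun i => ut i - u0 - t i *: (u1 i - u0)).

Definition scales (R : realType) (I : Type) (e t : I -> R) : Prop :=
  forall i, [/\ 0 <= e i, 0 <= t i & t i <= 1].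

Lemma scales_te2_le_e (R : realType) (I : Type) (e t : I -> R) : scales e t ->
  forall i, e i <= 1 -> t i * e i ^+ 2 <= e i.
Proof. by move=> et i e1; have [e0 t0 t1] := et i; rewrite expr2; nra. Qed.

Lemma scales_te2_le1 (R : realType) (I : Type) (e t : I -> R) : scales e t ->
  forall i, e i <= 1 -> t i * e i ^+ 2 <= 1.
Proof. by move=> et i e1; rewrite (le_trans (scales_te2_le_e et e1)). Qed.

Lemma chordal_bigO (R : realType) (I : Type) (e t : I -> R) (m n : nat)
    (u0 : 'M[R]_(m, n)) (u1 ut : I -> 'M[R]_(m, n)) :
  scales e t -> chordal e t u0 u1 ut -> bigO e e (fun i => ut i - u0).
Proof.
move=> et [H1 Ht].
apply: (@bigO_eq _ _ _ _ _ _ (fun i =>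
    (ut i - u0 - t i *: (u1 i - u0)) + t i *: (u1 i - u0)) _ 1) => //.
  by move=> i _; rewrite subrK.
apply: bigOD; first exact: bigO_weaken (scales_te2_le_e et) Ht.
apply: bigO_weaken (bigOZ t H1) => i _; have [e0 t0 t1] := et i.
by rewrite ger0_norm // ler_piMl.
Qed.

Lemma bigO_bounded (R : realType) (I : Type) (e : I -> R) (m n : nat)
    (u0 : 'M[R]_(m, n)) (u : I -> 'M[R]_(m, n)) :
  bigO e e (fun i => u i - u0) -> bigO e (fun=> 1) u.
Proof.
move=> H; apply: (@bigO_eq _ _ _ _ _ _ (fun i => (u i - u0) + u0) _ 1) => //.
  by move=> i _; rewrite subrK.
by apply: bigOD (bigO_cst e u0); apply: bigO_weaken H.
Qed.

Lemma bigO_subM (R : realType) (I : Type) (e : I -> R) (m n p : nat)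
    (u0 : 'M[R]_(m, n)) (u : I -> 'M[R]_(m, n)) (v0 : 'M[R]_(n, p)) (v : I -> 'M[R]_(n, p)) :
  bigO e e (fun i => u i - u0) -> bigO e e (fun i => v i - v0) ->
  bigO e e (fun i => u i *m v i - u0 *m v0).
Proof.
move=> Hu Hv.
apply: (@bigO_eq _ _ _ _ _ _ (fun i => (u i - u0) *m v i + u0 *m (v i - v0)) _ 1) => //.
  by move=> i _; rewrite mulmxBl mulmxBr addrA subrK.
by apply: bigOD; [apply: bigOMr (bigO_bounded Hv)|apply: bigOMl (bigO_cst _ _) Hv].
Qed.

Lemma chordalM (R : realType) (I : Type) (e t : I -> R) (m n p : nat)
    (u0 : 'M[R]_(m, n)) (u1 ut : I -> 'M[R]_(m, n))
    (v0 : 'M[R]_(n, p)) (v1 vt : I -> 'M[R]_(n, p)) :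
  scales e t -> chordal e t u0 u1 ut -> chordal e t v0 v1 vt ->
  chordal e t (u0 *m v0) (fun i => u1 i *m v1 i) (fun i => ut i *m vt i).
Proof.
move=> et Hu Hv; split; first exact: bigO_subM Hu.1 Hv.1.
have ut1 := bigO_bounded (chordal_bigO et Hu); have v11 := bigO_bounded Hv.1.
(* The product of two chords differs from the chord of the products by
   [(t^2 - t) (u1 - u0) (v1 - v0)], which is [O(t e^2)]; the other two terms carry the errors of the
   factors. *)
apply: (@bigO_eq _ _ _ _ _ _ (fun i => ut i *m (vt i - v0 - t i *: (v1 i - v0)) +
  (ut i - u0 - t i *: (u1 i - u0)) *m (v0 + t i *: (v1 i - v0)) +
  (t i ^+ 2 - t i) *: ((u1 i - u0) *m (v1 i - v0))) _ 1) => //.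
  move=> i _; rewrite !(mulmxDl, mulmxDr, mulmxBl, mulmxBr, mulNmx, mulmxN, =^~scalemxAl,
      =^~scalemxAr).
  move: (ut i *m vt i) (ut i *m v0) (ut i *m v1 i) (u0 *m v0) (u0 *m v1 i) (u1 i *m v0) (u1 i *m
      v1 i).
  by move=> *; apply/matrixP => j k; rewrite !mxE; ring.
apply: bigOD; first apply: bigOD.
- exact: bigOMl ut1 Hv.2.
- apply: bigOMr Hu.2 _; apply: bigOD (bigO_cst _ _) _.
  apply: bigO_weaken (bigOZ t Hv.1) => i e1; have [e0 t0 t1] := et i.
  by rewrite ger0_norm // (le_trans _ e1) // ler_piMl.
apply: bigO_weaken (bigOZ (fun i => t i ^+ 2 - t i) (bigOM Hu.1 Hv.1)) => i _;
    have [e0 t0 t1] := et i.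
rewrite -expr2 ler_wpM2r ?sqr_ge0 // distrC ger0_norm; nra.
Qed.

Lemma chordal_line (R : realType) (I : Type) (e t : I -> R) (m n : nat)
    (u0 : 'M[R]_(m, n)) (u1 : I -> 'M[R]_(m, n)) :
  scales e t -> bigO e e (fun i => u1 i - u0) ->
  chordal e t u0 u1 (fun i => u0 + t i *: (u1 i - u0)).
Proof.
move=> et H; split=> //; exists 0, 1; split=> // i _.
by rewrite [u0 + _]addrC addrK subrr mnorm0 mul0r.
Qed.

Lemma chordal_tr (R : realType) (I : Type) (e t : I -> R) (m n : nat)
    (u0 : 'M[R]_(m, n)) (u1 ut : I -> 'M[R]_(m, n)) :
  chordal e t u0 u1 ut -> chordal e t u0^T (fun i => (u1 i)^T) (fun i => (ut i)^T).
Proof.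
move=> [H1 Ht]; split.
  by apply: bigO_le H1 => i; rewrite -linearB /= mnorm_tr.
apply: bigO_le Ht => i.
have -> : (ut i)^T - u0^T - t i *: ((u1 i)^T - u0^T) = (ut i - u0 - t i *: (u1 i - u0))^T.
  by apply/matrixP => j k; rewrite !mxE.
by rewrite mnorm_tr.
Qed.

Lemma chordal_eq (R : realType) (I : Type) (e t : I -> R) (m n : nat)
    (u0 : 'M[R]_(m, n)) (u1 v1 ut : I -> 'M[R]_(m, n)) (d : R) :
  0 < d -> (forall i, e i <= d -> u1 i = v1 i) -> chordal e t u0 u1 ut -> chordal e t u0 v1 ut.
Proof.
move=> d0 uv [H1 Ht]; split; first by apply: (bigO_eq d0) H1 => i /uv ->.
by apply: (bigO_eq d0) Ht => i /uv ->.
Qed.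

Lemma chordal_inv (R : realType) (I : Type) (e t : I -> R) (n : nat) (u1 ut : I -> 'M[R]_n) :
  scales e t -> chordal e t 1%:M u1 ut ->
  chordal e t 1%:M (fun i => invmx (u1 i)) (fun i => invmx (ut i)).
Proof.
move=> et Hu; have Hut := chordal_bigO et Hu.
have [[d1 d10 u1u] u1V] := bigO_near1_inv Hu.1.
have [[dt dt0 utu] utV] := bigO_near1_inv Hut.
have V1 : bigO e e (fun i => invmx (u1 i) - 1%:M).
  apply: (bigO_eq d10) (bigON (bigOMl u1V Hu.1)) => i /u1u U.
  by rewrite mulmxBr mulVmx // mulmx1 opprB.
have Vt : bigO e e (fun i => invmx (ut i) - 1%:M).
  apply: (bigO_eq dt0) (bigON (bigOMl utV Hut)) => i /utu U.
  by rewrite mulmxBr mulVmx // mulmx1 opprB.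
split=> //.
(* The error of the inverse is minus [ut^-1] times the error of [ut], plus
   [t (u1^-1 - ut^-1) (u1 - I)], a product of two factors [O(e)] scaled by [t]. *)
apply: (@bigO_eq _ _ _ _ _ _ (fun i => - (invmx (ut i) *m (ut i - 1%:M - t i *: (u1 i - 1%:M)))
  + t i *: (((invmx (u1 i) - 1%:M) - (invmx (ut i) - 1%:M)) *m (u1 i - 1%:M))) _ (Num.min d1 dt)).
- by rewrite lt_min d10.
- move=> i; rewrite le_min => /andP[/u1u U1 /utu Ut].
  rewrite opprB addrA addrNK mulmxBl !mulmxBr -!scalemxAr !mulmxBr !mulmx1 !mulVmx //.
  move: (invmx (ut i) *m u1 i) (invmx (u1 i)) (invmx (ut i)) 1%:M.
  by move=> *; apply/matrixP => j k; rewrite !mxE; ring.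
apply: bigOD; first exact/bigON/(bigOMl utV Hu.2).
apply: bigO_weaken (bigOZ t (bigOM (bigOD V1 (bigON Vt)) Hu.1)) => i _.
by have [e0 t0 t1] := et i; rewrite ger0_norm // expr2.
Qed.

Lemma bigO_congr (R : realType) (I : Type) (e g : I -> R) (n : nat) (N M : I -> 'M[R]_n) :
  (forall i, e i <= 1 -> g i <= 1) -> bigO e g (fun i => N i - 1%:M) -> bigO e (fun=> 1) M ->
  bigO e g (fun i => N i *m M i *m (N i)^T - M i).
Proof.
move=> g1 HN HM.
have N1 : bigO e (fun=> 1) N.
  apply: (@bigO_eq _ _ _ _ _ _ (fun i => (N i - 1%:M) + 1%:M) _ 1) => //.
    by move=> i _; rewrite subrK.
  by apply: bigOD (bigO_cst _ _); apply: bigO_weaken HN.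
have HNT : bigO e g (fun i => (N i)^T - 1%:M).
  by apply: bigO_le HN => i; rewrite -mnorm_tr linearB /= trmx1 trmxK.
apply: (@bigO_eq _ _ _ _ _ _
  (fun i => (N i - 1%:M) *m (M i *m (N i)^T) + M i *m ((N i)^T - 1%:M)) _ 1) => //.
  by move=> i _; rewrite mulmxBl mulmxBr mulmx1 mul1mx mulmxA addrA subrK.
apply: bigOD; last exact: bigOMl HM HNT.
by apply: bigOMr HN _; apply: bigOMl HM _; apply: bigO_tr.
Qed.

(** * Curves in the graph *)

Lemma mnorm_orthogonal (R : realType) (n : nat) (Q : 'M[R]_n) : Q *m Q^T = 1%:M ->
  mnorm Q <= (n * n)%:R.
Proof.
move=> QQ; have le1 i j : `|Q i j| <= 1.
  rewrite -sqrtr_sqr -sqrtr1 ler_wsqrtr //.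
  have /matrixP/(_ i i) := QQ; rewrite !mxE eqxx mulr1n (bigD1 j) //= mxE -expr2 => <-.
  by rewrite lerDl sumr_ge0 // => k _; rewrite mxE -expr2 sqr_ge0.
apply: (@le_trans _ _ (\sum_(i < n) \sum_(j < n) 1)).
  by apply: ler_sum => i _; apply: ler_sum.
by rewrite !sumr_const !card_ord -mulrnA.
Qed.

Lemma mnorm_diag (R : realType) (n : nat) (d : 'rV[R]_n) : mnorm (diag_mx d) = mnorm d.
Proof.
rewrite /mnorm [RHS]big_ord1; apply: eq_bigr => i _.
by rewrite (bigD1 i) //= big1 => [|j /negPf ji]; rewrite mxE ?eqxx ?addr0 // eq_sym ji normr0.
Qed.

(** With [r = sqrt x], [r^-1 - 1 = - (x - 1) / (r (r + 1))], and [r >= 1/2] keeps the denominator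
    above [1/2]. *)
Lemma inv_sqrt_near1 (R : realType) (x : R) : `|x - 1| <= 1 / 2 ->
  `|(Num.sqrt x)^-1 - 1| <= 2 * `|x - 1|.
Proof.
move=> x1; have x0 : 0 <= x by move: x1; rewrite ler_norml => /andP[]; lra.
set r := Num.sqrt x; have rr : r ^+ 2 = x := sqr_sqrtr x0; have r0 : 0 <= r := sqrtr_ge0 x.
have r_half : 1 / 2 <= r by move: x1; rewrite ler_norml => /andP[]; nra.
have r_gt0 : 0 < r by lra.
have -> : r^-1 - 1 = - ((x - 1) / (r * (r + 1))) by rewrite -rr; field; rewrite !gt_eqF //; lra.
rewrite normrN normrM mulrC ler_wpM2r // ger0_norm ?invr_ge0 ?mulr_ge0 //; last by lra.
have rr1 : 0 < r * (r + 1) by rewrite mulr_gt0 //; lra.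
by rewrite -[2]invrK lef_pV2 ?posrE ?invr_gt0 //; nra.
Qed.

Lemma mnormM3 (R : realType) (m n p q : nat) (A : 'M[R]_(m, n)) (B : 'M[R]_(n, p))
    (C : 'M[R]_(p, q)) (K : R) : mnorm A <= K -> mnorm C <= K ->
  mnorm (A *m B *m C) <= K ^+ 2 * mnorm B.
Proof.
move=> AK CK; rewrite (le_trans (mnormM _ _)) // expr2 mulrAC ler_pM ?mnorm_ge0 //.
by rewrite (le_trans (mnormM _ _)) // ler_wpM2r ?mnorm_ge0.
Qed.

(** The normaliser is the inverse square root of [P], taken in an eigenbasis; since the eigenbasis
    depends on [P], the function is obtained by choice. *)
Lemma near1_normalizer (R : realType) (n : nat) :
  exists f : 'M[R]_n -> 'M[R]_n, exists C d, [/\ 0 <= C, 0 < d &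
    forall P, P^T = P -> mnorm (P - 1%:M) <= d ->
      f P *m P *m (f P)^T = 1%:M /\ mnorm (f P - 1%:M) <= C * mnorm (P - 1%:M)].
Proof.
(* [K] bounds both [n] and the norm of every orthogonal matrix, and the 1 keeps it positive for
   [n = 0]. Passing to the eigenbasis costs [K^2], the scalar inverse square root 2, the sum over
   the diagonal [K], and passing back [K^2]: in all [2 K^5]. *)
pose K : R := (n * n)%:R + 1; have K1 : 1 <= K by rewrite lerDr ler0n.
have [f fP] : exists f : 'M[R]_n -> 'M[R]_n, forall P,
    P^T = P -> mnorm (P - 1%:M) <= (2 * K ^+ 2)^-1 ->
    f P *m P *m (f P)^T = 1%:M /\ mnorm (f P - 1%:M) <= 2 * K ^+ 5 * mnorm (P - 1%:M).
  suff /choice [f fP] : forall P : 'M[R]_n, exists L :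
      'M[R]_n, P^T = P -> mnorm (P - 1%:M) <= (2 * K ^+ 2)^-1 ->
    L *m P *m L^T = 1%:M /\ mnorm (L - 1%:M) <= 2 * K ^+ 5 * mnorm (P - 1%:M) by exists f.
  move=> P; have [symP|] := pselect (P^T = P); last by exists 0.
  have [Q [d [QQ PE]]] := symmetric_spectral symP; have QQ' := mulmx1C QQ.
  have QK : mnorm Q <= K by rewrite (le_trans (mnorm_orthogonal QQ)) // lerDl.
  have QTK : mnorm Q^T <= K by rewrite mnorm_tr.
  exists (Q^T *m diag_mx (map_mx (fun x => (Num.sqrt x)^-1) d) *m Q) => _ Psmall.
  set D := diag_mx (map_mx _ d).
  have dE : diag_mx (d - const_mx 1) = Q *m (P - 1%:M) *m Q^T.
    rewrite linearB /= diag_const_mx mulmxBr mulmxBl mulmx1 QQ PE !mulmxA QQ mul1mx.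
    by rewrite -mulmxA QQ mulmx1.
  have d1 i : `|d 0 i - 1| <= K ^+ 2 * mnorm (P - 1%:M).
    have -> : d 0 i - 1 = diag_mx (d - const_mx 1) i i by rewrite !mxE eqxx.
    by rewrite dE (le_trans (mnorm_entry _ _ _)) // mnormM3.
  have d_half i : `|d 0 i - 1| <= 1 / 2.
    rewrite (le_trans (d1 i)) // mulrC -ler_pdivlMr ?exprn_gt0 //; last by lra.
    by rewrite (le_trans Psmall) // invfM mul1r.
  have d_gt0 i : 0 < d 0 i by have := d_half i; rewrite ler_norml => /andP[]; lra.
  have DT : D^T = D by rewrite tr_diag_mx.
  split.
    have -> : (Q^T *m D *m Q)^T = Q^T *m D *m Q by rewrite !trmx_mul trmxK DT mulmxA.
    rewrite PE !mulmxA -[_ *m Q *m Q^T]mulmxA QQ mulmx1 -[_ *m Q *m Q^T]mulmxA QQ mulmx1.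
    rewrite -[_ *m D *m diag_mx d]mulmxA -[_ *m _ *m D]mulmxA.
    suff -> : D *m diag_mx d *m D = 1%:M by rewrite mulmx1.
    rewrite mul_diag_mx mul_mx_diag; apply/matrixP => i j; rewrite !mxE.
    have [<-|] := eqVneq i j; last by rewrite !mulr0n mulr0 mul0r.
    rewrite !mulr1n -{2}[d 0 i]sqr_sqrtr ?ltW //.
    by have : 0 < Num.sqrt (d 0 i); [rewrite sqrtr_gt0|move=> /lt0r_neq0 r0; field].
  have -> : Q^T *m D *m Q - 1%:M = Q^T *m (D - 1%:M) *m Q by rewrite mulmxBr mulmxBl mulmx1 QQ'.
  rewrite (le_trans (mnormM3 _ QTK QK)) //.
  have -> : D - 1%:M = diag_mx (map_mx (fun x => (Num.sqrt x)^-1) d - const_mx 1).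
    by rewrite linearB /= diag_const_mx.
  rewrite mnorm_diag {1}/mnorm big_ord1.
  apply: (@le_trans _ _ (K ^+ 2 * (\sum_(i < n) 2 * (K ^+ 2 * mnorm (P - 1%:M))))).
    rewrite ler_wpM2l ?exprn_ge0 //; first by lra.
    apply: ler_sum => i _; rewrite !mxE (le_trans (inv_sqrt_near1 (d_half i))) //.
    by rewrite ler_wpM2l.
  rewrite sumr_const card_ord -[_ *+ n]mulr_natr.
  have nK : n%:R <= K.
    by rewrite /K natr1 ler_nat; case: (n) => // k; rewrite leqW // leq_pmulr.
  rewrite [leRHS](_ : _ = K ^+ 2 * (2 * (K ^+ 2 * mnorm (P - 1%:M)) * K)); last by ring.
  rewrite ler_wpM2l ?exprn_ge0 //; first by lra.
  by rewrite ler_wpM2l // !mulr_ge0 ?mnorm_ge0 //; lra.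
exists f, (2 * K ^+ 5), (2 * K ^+ 2)^-1; split=> //.
  by rewrite mulr_ge0 // exprn_ge0 //; lra.
by rewrite invr_gt0 mulr_gt0 // exprn_gt0 //; lra.
Qed.

(* The two dilations of a graph point; [X Y^T] and [Y^T X] are the absolute values
   [(X X^T)^(1/2)] and [(X^T X)^(1/2)]. *)
Definition dilA (R : realType) (m n : nat) (X Y : 'M[R]_(m, n)) : 'M[R]_(m + n) :=
  block_mx (X *m Y^T) (- X) (- X^T) (Y^T *m X).

Definition dilB (R : realType) (m n : nat) (Y : 'M[R]_(m, n)) : 'M[R]_(m + n) :=
  block_mx 1%:M Y Y^T 1%:M.

(** With [F] the column of [I] and [- Y^T], the first dilation is [F A F^T], while [F^T] times the
    second has the blocks [I - Y Y^T] and 0, so [A] kills it. The second dilation is semidefinite by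
    its Schur complement [I - Y Y^T]. *)
Lemma gph_dilation (R : realType) (m n : nat) (X Y : 'M[R]_(m, n)) :
  gph_subdiff_nuclear R m n (X, Y) ->
  [/\ psd (dilA X Y), psd (dilB Y) & dilA X Y *m dilB Y = 0].
Proof.
move=> /gph_subdiff_nuclearP [A [psdA Y1 XE AY]].
have AYY : A *m Y *m Y^T = A
    by apply/eqP; rewrite eq_sym -subr_eq0 -mulmxA -{1}[A]mulmx1 -mulmxBr AY.
pose F : 'M[R]_(m + n, m) := col_mx 1%:M (- Y^T).
have AE : dilA X Y = F *m A *m F^T.
  rewrite /F tr_col_mx mul_col_mx mul_col_row trmx1 linearN /= trmxK !mulmx1 mul1mx.
  by rewrite /dilA XE trmx_mul psdA.1 AYY mulmxN !mulNmx mulmxN opprK !mulmxA.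
split.
- by rewrite AE; apply: psd_congr.
- have -> : dilB Y = col_mx 1%:M 0 *m (1%:M - Y *m Y^T) *m (col_mx 1%:M 0)^T +
      col_mx Y 1%:M *m 1%:M *m (col_mx Y 1%:M)^T.
    rewrite mulmx1 !tr_col_mx [_ *m (1%:M - _)]mul_col_mx !mul_col_row add_block_mx !trmx1 trmx0.
    by rewrite !(mulmx1, mul1mx, mul0mx, mulmx0, add0r, addr0) subrK.
  by apply: psdD; apply: psd_congr => //; apply: psd1.
- have -> : dilA X Y *m dilB Y = F *m (A *m (F^T *m dilB Y)) by rewrite AE !mulmxA.
  rewrite /F tr_col_mx mul_row_block trmx1 linearN /= trmxK !mul1mx mulmx1 mulNmx addrN.
  by rewrite mul_mx_row AY mulmx0 row_mx0 mulmx0.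
Qed.

(** [M] need not have the shape of a dilation: the top row of [M dilB = 0] says that the upper left
    block is a witness [A] for the point [(- ursubmx M, Y)]. *)
Lemma dilation_gph (R : realType) (m n : nat) (M : 'M[R]_(m + n)) (Y : 'M[R]_(m, n)) :
  psd M -> psd (dilB Y) -> M *m dilB Y = 0 -> gph_subdiff_nuclear R m n (- ursubmx M, Y).
Proof.
move=> psdM psdB MB; apply/gph_subdiff_nuclearP; exists (ulsubmx M).
have := MB; rewrite -{1}[M]submxK mulmx_block -[0]block_mx0 => /eq_block_mx [].
rewrite !mulmx1 => ab0 ba0 _ _.
have bE : - ursubmx M = ulsubmx M *m Y by apply/eqP; rewrite eq_sym -subr_eq0 opprK ba0.
split=> //.
- have := psd_congr (row_mx 1%:M 0) psdM.
  by rewrite -{1}[M]submxK mul_row_block tr_row_mx mul_row_col trmx1 trmx0 !(mul1mx, mulmx1,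
      mul0mx, mulmx0, addr0).
- have := psd_congr (row_mx 1%:M (- Y)) psdB.
  rewrite mul_row_block tr_row_mx mul_row_col trmx1 !(mul1mx,
      mulmx1) linearN /= mulNmx addrN mul0mx addr0.
  done.
- rewrite mulmxBr mulmx1 mulmxA -bE mulNmx opprK.
  by rewrite ab0.
Qed.

(** * Curves of complementary semidefinite pairs *)

Lemma psd_pinv (R : realType) (n : nat) (A : 'M[R]_n) : psd A ->
  exists P : 'M[R]_n, P^T = P /\ A *m P *m A = A.
Proof.
move=> /psd_spectral [Q [d [QQ QQ' -> d0]]].
(* As the inverse of 0 is 0, this gives the Moore-Penrose inverse in the eigenbasis. *)
pose D := diag_mx (map_mx GRing.inv d).
have DT : D^T = D by rewrite tr_diag_mx.
have mulQ (S T : 'M[R]_n) : Q^T *m S *m Q *m (Q^T *m T *m Q) = Q^T *m (S *m T) *m Q.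
  by rewrite !mulmxA -[_ *m Q *m Q^T]mulmxA QQ mulmx1.
exists (Q^T *m D *m Q); split.
  by rewrite !trmx_mul trmxK DT mulmxA.
rewrite !mulQ; congr (_ *m _ *m _); rewrite mul_diag_mx mul_mx_diag.
apply/matrixP => i j; rewrite !mxE; have [->|_] := eqVneq i j; last by rewrite !mulr0n mulr0 mul0r.
rewrite !mulr1n; have [->|di] := eqVneq (d 0 j) 0; first by rewrite mulr0.
by rewrite divff // mul1r.
Qed.

Lemma psd_chord (R : realType) (n : nat) (t : R) (A B : 'M[R]_n) : 0 <= t -> t <= 1 ->
  psd A -> psd B -> psd (A + t *: (B - A)).
Proof.
move=> t0 t1 psdA psdB; have -> : A + t *: (B - A) = (1 - t) *: A + t *: B.
  by rewrite scalerBr scalerBl scale1r addrA addrAC.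
by apply: psdD; apply: psdZ => //; rewrite subr_ge0.
Qed.

Lemma mulmx_chord_eq0 (R : realType) (n : nat) (t : R) (A0 A1 B0 B1 : 'M[R]_n) :
  A0 *m B0 = 0 -> A0 *m B1 = 0 -> A1 *m B0 = 0 -> A1 *m B1 = 0 ->
  (A0 + t *: (A1 - A0)) *m (B0 + t *: (B1 - B0)) = 0.
Proof.
move=> AB00 AB01 AB10 AB11.
rewrite mulmxDl !mulmxDr -!scalemxAl -!scalemxAr !mulmxBl !mulmxBr AB00 AB01 AB10 AB11.
by rewrite !(subr0, scaler0, addr0).
Qed.

(* In the proof [A1 = G A3 G^T] and [B1 = G^-T B3 G^-1] with [G = L K^-1]: the congruence [L] makes
   the range of [A0] orthogonal to the range of [B2 = L^T B1 L], and [K] then does the same for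
   [B0] and [A3] without spoiling this. *)
Lemma complementary_curve (R : realType) (I : Type) (e t : I -> R) (n : nat)
    (A0 B0 : 'M[R]_n) (A1 B1 : I -> 'M[R]_n) :
  scales e t ->
  psd A0 -> psd B0 -> A0 *m B0 = 0 ->
  (forall i, [/\ psd (A1 i), psd (B1 i) & A1 i *m B1 i = 0]) ->
  bigO e e (fun i => A1 i - A0) -> bigO e e (fun i => B1 i - B0) ->
  exists At Bt : I -> 'M[R]_n, exists d, [/\ 0 < d,
    forall i, e i <= d -> [/\ psd (At i), psd (Bt i) & At i *m Bt i = 0],
    chordal e t A0 A1 At & chordal e t B0 B1 Bt].
Proof.
move=> et psdA0 psdB0 AB0 AB1 HA HB.
have [Ap [ApT AAp]] := psd_pinv psdA0.
have [Bp [_ BBp]] := psd_pinv psdB0.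
have sym0 (S T : 'M[R]_n) : S^T = S -> T^T = T -> S *m T = 0 -> T *m S = 0.
  by move=> sS sT ST; rewrite -[LHS]trmxK trmx_mul sS sT ST trmx0.
have congrK (S T W : 'M[R]_n) : S *m T = 1%:M -> S *m (T *m W *m T^T) *m S^T = W.
  by move=> ST; rewrite !mulmxA ST mul1mx -mulmxA -trmx_mul ST trmx1 mulmx1.
have BA0 : B0 *m A0 = 0 by apply: sym0 AB0; [exact: psdA0.1|exact: psdB0.1].
have BA1 i : B1 i *m A1 i = 0.
  by have [[sA _] [sB _] AB] := AB1 i; apply: sym0 AB.
(* Chosen so that [A0 L^T = A0 Ap A1]; with [A1 B1 = 0] this yields [A0 B2 = 0]. *)
pose L i := 1%:M + (A1 i - A0) *m Ap.
pose B2 i := (L i)^T *m B1 i *m L i.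
(* Chosen so that [B0 K = B0 Bp B2], which yields [B0 A3 = 0]; and [K A0 = A0], because [B2] and
   [B0] both kill [A0]. *)
pose K i := 1%:M + Bp *m (B2 i - B0).
have HL : bigO e e (fun i => L i - 1%:M).
  apply: (@bigO_eq _ _ _ _ _ _ (fun i => (A1 i - A0) *m Ap) _ 1) => //.
    by move=> i _; rewrite /L [RHS]addrC addKr.
  exact: bigOMr HA (bigO_cst _ _).
have HLT : bigO e e (fun i => (L i)^T - 1%:M).
  by apply: bigO_le HL => i; rewrite -mnorm_tr linearB /= trmxK trmx1.
have HB2 : bigO e e (fun i => B2 i - B0).
  have := bigO_subM (bigO_subM HLT HB) HL.
  by apply: bigO_le => i; rewrite mul1mx mulmx1.
have HK : bigO e e (fun i => K i - 1%:M).
  apply: (@bigO_eq _ _ _ _ _ _ (fun i => Bp *m (B2 i - B0)) _ 1) => //.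
    by move=> i _; rewrite /K [RHS]addrC addKr.
  exact: bigOMl (bigO_cst _ _) HB2.
pose Lt i := 1%:M + t i *: (L i - 1%:M); pose Kt i := 1%:M + t i *: (K i - 1%:M).
have CL : chordal e t 1%:M L Lt by apply: chordal_line.
have CK : chordal e t 1%:M K Kt by apply: chordal_line.
have [[dL dL0 Lu] _] := bigO_near1_inv HL.
have [[dK dK0 Ku] _] := bigO_near1_inv HK.
have [[dLt dLt0 Ltu] _] := bigO_near1_inv (chordal_bigO et CL).
have [[dKt dKt0 Ktu] _] := bigO_near1_inv (chordal_bigO et CK).
pose d := Num.min (Num.min dL dK) (Num.min dLt dKt).
have d0 : 0 < d by rewrite !lt_min dL0 dK0 dLt0 dKt0.
have units i : e i <= d -> [/\ L i \in unitmx, K i \in unitmx, Lt i \in unitmx & Kt i \in unitmx].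
  by rewrite !le_min => /andP[/andP[/Lu ? /Ku ?] /andP[/Ltu ? /Ktu ?]].
pose G i := L i *m invmx (K i); pose H i := K i *m invmx (L i).
pose Gt i := Lt i *m invmx (Kt i); pose Ht i := Kt i *m invmx (Lt i).
have CG : chordal e t 1%:M G Gt.
  by have := chordalM et CL (chordal_inv et CK); rewrite mulmx1.
have CH : chordal e t 1%:M H Ht.
  by have := chordalM et CK (chordal_inv et CL); rewrite mulmx1.
have HG i : e i <= d -> H i *m G i = 1%:M.
  by move=> /units[Li Ki _ _]; rewrite /H /G mulmxA mulmxKV // mulmxV.
have HGt i : e i <= d -> Ht i *m Gt i = 1%:M.
  by move=> /units[_ _ Li Ki]; rewrite /Ht /Gt mulmxA mulmxKV // mulmxV.
pose A3 i := H i *m A1 i *m (H i)^T; pose B3 i := (G i)^T *m B1 i *m G i.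
have HA3 : bigO e e (fun i => A3 i - A0).
  have := bigO_subM (bigO_subM CH.1 HA) (chordal_tr CH).1.
  by apply: bigO_le => i; rewrite trmx1 mul1mx mulmx1.
have HB3 : bigO e e (fun i => B3 i - B0).
  have := bigO_subM (bigO_subM (chordal_tr CG).1 HB) CG.1.
  by apply: bigO_le => i; rewrite trmx1 mul1mx mulmx1.
pose A4 i := A0 + t i *: (A3 i - A0); pose B4 i := B0 + t i *: (B3 i - B0).
have CA4 : chordal e t A0 A3 A4 by apply: chordal_line.
have CB4 : chordal e t B0 B3 B4 by apply: chordal_line.
(* The chord between the straightened pairs is carried back by the congruence of time [t]. As [Ht]
   inverts [Gt], the product of the two matrices is [Gt A4 B4 Ht], so it vanishes with [A4 B4]. *)
exists (fun i => Gt i *m A4 i *m (Gt i)^T), (fun i => (Ht i)^T *m B4 i *m Ht i), d; split=> //.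
- move=> i ed; have [psdA1 psdB1 AB1i] := AB1 i; have [e0 t0 t1] := et i;
    have [Li Ki _ _] := units i ed.
  split.
  - by apply: psd_congr; apply: psd_chord => //; apply: psd_congr.
  - by apply: psd_congrT; apply: psd_chord => //; apply: psd_congrT.
  have HGT : (Gt i)^T *m (Ht i)^T = 1%:M by rewrite -trmx_mul HGt // trmx1.
  rewrite -!mulmxA [(Gt i)^T *m _]mulmxA HGT mul1mx [A4 i *m _]mulmxA.
  suff -> : A4 i *m B4 i = 0 by rewrite mul0mx !mulmx0.
  have AB3 : A3 i *m B3 i = 0.
    rewrite /A3 /B3 -!mulmxA [(H i)^T *m _]mulmxA -trmx_mul.
    have -> : G i *m H i = 1%:M by apply/mulmx1C/HG.
    by rewrite trmx1 mul1mx [A1 i *m _]mulmxA AB1i mul0mx !mulmx0.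
  have ALB : A0 *m B2 i = 0.
    have A0L : A0 *m (L i)^T = A0 *m Ap *m A1 i.
      rewrite /L linearD /= trmx1 trmx_mul linearB /= ApT psdA0.1 psdA1.1 mulmxDr mulmx1 mulmxBr
          mulmxBr.
      by rewrite !mulmxA AAp addrC subrK.
    by rewrite /B2 !mulmxA A0L -[_ *m A1 i *m B1 i]mulmxA AB1i mulmx0 mul0mx.
  have BLA : B2 i *m A0 = 0.
    have sB2 : (B2 i)^T = B2 i by exact: (psd_congrT (L i) psdB1).1.
    exact: sym0 psdA0.1 sB2 ALB.
  have KA : K i *m A0 = A0.
    by rewrite /K mulmxDl mul1mx -mulmxA mulmxBl BLA BA0 subrr mulmx0 addr0.
  (* Since [K] fixes [A0], so does its inverse, and the orthogonality [B2 A0 = 0] passes to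
     [B3 = K^-T B2 K^-1]. *)
  have VKA : invmx (K i) *m A0 = A0 by rewrite -{1}KA mulKmx.
  have B03 : B3 i *m A0 = 0.
    have -> : B3 i = (invmx (K i))^T *m B2 i *m invmx (K i).
      by rewrite /B3 /G trmx_mul /B2 !mulmxA.
    have -> : forall V : 'M[R]_n, V^T *m B2 i *m V *m A0 = V^T *m (B2 i *m (V *m A0)).
      by move=> V; rewrite !mulmxA.
    by rewrite VKA BLA mulmx0.
  have A0B3 : A0 *m B3 i = 0.
    have sB3 : (B3 i)^T = B3 i by exact: (psd_congrT (G i) psdB1).1.
    exact: sym0 sB3 psdA0.1 B03.
  have B0A3 : B0 *m A3 i = 0.
    have B0K : B0 *m K i = B0 *m Bp *m B2 i.
      by rewrite /K mulmxDr mulmx1 !mulmxBr !mulmxA BBp addrC subrK.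
    (* Here [B2 L^-1 = L^T B1], and [B1 A1 = 0]. *)
    have B2A : B2 i *m invmx (L i) *m A1 i = 0 by rewrite /B2 mulmxK // -mulmxA BA1 mulmx0.
    rewrite /A3 /H !mulmxA B0K -[_ *m B2 i *m _]mulmxA -[_ *m (B2 i *m _) *m A1 i]mulmxA B2A.
    by rewrite mulmx0 mul0mx.
  have A3B0 : A3 i *m B0 = 0.
    have sA3 : (A3 i)^T = A3 i by exact: (psd_congr (H i) psdA1).1.
    exact: sym0 psdB0.1 sA3 B0A3.
  exact: mulmx_chord_eq0.
- have := chordalM et (chordalM et CG CA4) (chordal_tr CG); rewrite trmx1 mul1mx mulmx1.
  apply: (chordal_eq d0) => i ed.
  have GH : G i *m H i = 1%:M by apply/mulmx1C/HG.
  exact: congrK.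
- have := chordalM et (chordalM et (chordal_tr CH) CB4) CH; rewrite trmx1 mul1mx mulmx1.
  apply: (chordal_eq d0) => i ed.
  have GH : G i *m H i = 1%:M by apply/mulmx1C/HG.
  by have := @congrK (H i)^T (G i)^T (B1 i); rewrite -trmx_mul GH trmx1 !trmxK; apply.
Qed.

Lemma ulsubmx_residual (R : realType) (m n : nat) (t : R) (A B C : 'M[R]_(m + n)) :
  ulsubmx (A - B - t *: (C - B)) = ulsubmx A - ulsubmx B - t *: (ulsubmx C - ulsubmx B).
Proof. by apply/matrixP => i j; rewrite !mxE. Qed.

Lemma drsubmx_residual (R : realType) (m n : nat) (t : R) (A B C : 'M[R]_(m + n)) :
  drsubmx (A - B - t *: (C - B)) = drsubmx A - drsubmx B - t *: (drsubmx C - drsubmx B).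
Proof. by apply/matrixP => i j; rewrite !mxE. Qed.

Lemma ursubmx_residual (R : realType) (m n : nat) (t : R) (A B C : 'M[R]_(m + n)) :
  ursubmx (A - B - t *: (C - B)) = ursubmx A - ursubmx B - t *: (ursubmx C - ursubmx B).
Proof. by apply/matrixP => i j; rewrite !mxE. Qed.

(** The complementary curve through the dilations has diagonal blocks in [Bt] that are only close to
    [I]. A block diagonal congruence restores them, with the inverse transposed congruence on [At],
    so complementarity and semidefiniteness survive; [dilation_gph] then reads off a graph point. *)
Lemma dilation_curve (R : realType) (I : Type) (e t : I -> R) (m n : nat)
    (X0 Y0 : 'M[R]_(m, n)) (X1 Y1 : I -> 'M[R]_(m, n)) :
  scales e t ->
  gph_subdiff_nuclear R m n (X0, Y0) -> (forall i, gph_subdiff_nuclear R m n (X1 i, Y1 i)) ->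
  bigO e e (fun i => X1 i - X0) -> bigO e e (fun i => Y1 i - Y0) ->
  exists Xt Yt : I -> 'M[R]_(m, n), exists d, [/\ 0 < d,
    forall i, e i <= d -> gph_subdiff_nuclear R m n (Xt i, Yt i),
    chordal e t X0 X1 Xt & chordal e t Y0 Y1 Yt].
Proof.
move=> et g0 g1 HX HY.
have trB p q (u0 : 'M[R]_(p, q)) u : bigO e e (fun i => u i - u0) ->
    bigO e e (fun i => (u i)^T - u0^T).
  by apply: bigO_le => i; rewrite -mnorm_tr linearB /= !trmxK.
have negB p q (u0 : 'M[R]_(p, q)) u : bigO e e (fun i => u i - u0) ->
    bigO e e (fun i => - u i - - u0).
  by apply: bigO_le => i; rewrite -mnormN opprB opprK addrC.
have const0 p q (u0 : 'M[R]_(p, q)) : bigO e e (fun i => u0 - u0).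
  by exists 0, 1; split=> // i _; rewrite subrr mnorm0 mul0r.
have blockB p q p' q' (a0 : 'M[R]_(p, q)) (b0 : 'M[R]_(p, q')) (c0 : 'M[R]_(p', q))
    (d0 : 'M[R]_(p', q')) a b c d :
    bigO e e (fun i => a i - a0) -> bigO e e (fun i => b i - b0) ->
    bigO e e (fun i => c i - c0) -> bigO e e (fun i => d i - d0) ->
    bigO e e (fun i => block_mx (a i) (b i) (c i) (d i) - block_mx a0 b0 c0 d0).
  move=> Ha Hb Hc Hd; apply: (bigO_eq (d := 1)) (bigO_block Ha Hb Hc Hd) => // i _.
  by rewrite opp_block_mx add_block_mx.
have HA : bigO e e (fun i => dilA (X1 i) (Y1 i) - dilA X0 Y0).
  apply: blockB; [exact: bigO_subM HX (trB _ _ _ _ HY)|exact: negB|exact/negB/trB|].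
  exact: bigO_subM (trB _ _ _ _ HY) HX.
have HB : bigO e e (fun i => dilB (Y1 i) - dilB Y0).
  by apply: blockB => //; apply: trB.
have [psdA0 psdB0 AB0] := gph_dilation g0.
have [At [Bt [d [d0 ABt CA CB]]]] :=
  complementary_curve et psdA0 psdB0 AB0 (fun i => gph_dilation (g1 i)) HA HB.
have te1 := scales_te2_le1 et.
(* Both ends of the chord have diagonal blocks [I], so these blocks of [Bt] deviate from [I] by the
   chordal error alone. The normalisation therefore costs only [O(t e^2)]. *)
have HP : bigO e (fun i => t i * e i ^+ 2) (fun i => ulsubmx (Bt i) - 1%:M).
  apply: bigO_le CB.2 => i; apply: le_trans (mnorm_ulsubmx _).
  by rewrite ulsubmx_residual /dilB !block_mxKul subrr scaler0 subr0.
have HQ : bigO e (fun i => t i * e i ^+ 2) (fun i => drsubmx (Bt i) - 1%:M).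
  apply: bigO_le CB.2 => i; apply: le_trans (mnorm_drsubmx _).
  by rewrite drsubmx_residual /dilB !block_mxKdr subrr scaler0 subr0.
have normalize k (P : I -> 'M[R]_k) : (forall i, e i <= d -> (P i)^T = P i) ->
    bigO e (fun i => t i * e i ^+ 2) (fun i => P i - 1%:M) ->
    exists N : I -> 'M[R]_k, bigO e (fun i => t i * e i ^+ 2) (fun i => N i - 1%:M) /\
      exists2 d', 0 < d' & forall i, e i <= d' -> N i *m P i *m (N i)^T = 1%:M.
  move=> symP HP'; have [f [C [d1 [C0 d10 fP]]]] := near1_normalizer R k.
  have [d2 d20 small] := bigO_small d10 (bigO_weaken (scales_te2_le_e et) HP').
  have [CP [d3 [CP0 d30 leP]]] := HP'.
  exists (fun i => f (P i)); split.
    exists (C * CP), (Num.min d (Num.min d2 d3)); split; first exact: mulr_ge0.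
      by rewrite !lt_min d0 d20.
    move=> i; rewrite !le_min => /and3P[/symP sP /small Ps /leP Pe].
    by rewrite (le_trans (fP _ sP Ps).2) // -mulrA ler_wpM2l.
  exists (Num.min d d2); first by rewrite lt_min d0.
  by move=> i; rewrite le_min => /andP[/symP sP /small Ps]; have [] := fP _ sP Ps.
have symB i : e i <= d -> (Bt i)^T = Bt i by move=> /ABt[_ []].
have [N1 [HN1 [d1 d10 N1P]]] : exists N : I -> 'M[R]_m, bigO e (fun i =>
    t i * e i ^+ 2) (fun i => N i - 1%:M) /\
    exists2 d', 0 < d' & forall i, e i <= d' -> N i *m ulsubmx (Bt i) *m (N i)^T = 1%:M.
  by apply: normalize => // i /symB sB; rewrite trmx_ulsub sB.
have [N2 [HN2 [d2 d20 N2P]]] : exists N : I -> 'M[R]_n, bigO e (fun i =>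
    t i * e i ^+ 2) (fun i => N i - 1%:M) /\
    exists2 d', 0 < d' & forall i, e i <= d' -> N i *m drsubmx (Bt i) *m (N i)^T = 1%:M.
  by apply: normalize => // i /symB sB; rewrite trmx_drsub sB.
pose N i : 'M[R]_(m + n) := block_mx (N1 i) 0 0 (N2 i).
have HN : bigO e (fun i => t i * e i ^+ 2) (fun i => N i - 1%:M).
  have H0 p q : bigO e (fun i => t i * e i ^+ 2) (fun=> (0 : 'M[R]_(p, q))).
    by exists 0, 1; split=> // i _; rewrite mnorm0 mul0r.
  apply: (bigO_eq (d := 1)) (bigO_block HN1 (H0 _ _) (H0 _ _) HN2) => // i _.
  by rewrite /N scalar_mx_block opp_block_mx add_block_mx !oppr0 !addr0.
have [[d3 d30 Nu] VN1] := bigO_near1_inv (bigO_weaken (scales_te2_le_e et) HN).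
pose V i := (invmx (N i))^T.
have HV : bigO e (fun i => t i * e i ^+ 2) (fun i => V i - 1%:M).
  apply: (bigO_eq d30) (bigO_tr (bigON (bigOMl VN1 HN))) => i /Nu U.
  by rewrite mulmxBr mulVmx // mulmx1 opprB linearB /= trmx1.
pose Bn i := N i *m Bt i *m (N i)^T; pose An i := V i *m At i *m (V i)^T.
have HBn : bigO e (fun i => t i * e i ^+ 2) (fun i => Bn i - Bt i).
  by apply: bigO_congr => //; apply: bigO_bounded (chordal_bigO et CB).
have HAn : bigO e (fun i => t i * e i ^+ 2) (fun i => An i - At i).
  by apply: bigO_congr => //; apply: bigO_bounded (chordal_bigO et CA).
exists (fun i => - ursubmx (An i)), (fun i =>
    ursubmx (Bn i)), (Num.min d (Num.min d1 (Num.min d2 d3))).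
split; first by rewrite !lt_min d0 d10 d20.
- move=> i; rewrite !le_min => /and4P[/ABt[psdA psdB AB] /N1P P1 /N2P P2 /Nu U].
  have psdBn : psd (Bn i) by apply: psd_congr.
  (* The normalised diagonal blocks are [I], and symmetry makes the lower left block the transpose
     of the upper right one. *)
  have BE : Bn i = dilB (ursubmx (Bn i)).
    rewrite -{1}[Bn i]submxK /dilB; congr block_mx.
    + by rewrite /Bn -[Bt i]submxK tr_block_mx !trmx0 !mulmx_block !block_mxKul
        !(mulmx0, mul0mx, addr0, add0r).
    + by rewrite -[LHS]trmxK trmx_dlsub psdBn.1.
    + by rewrite /Bn -[Bt i]submxK tr_block_mx !trmx0 !mulmx_block !block_mxKdr
        !(mulmx0, mul0mx, addr0, add0r).
  apply: dilation_gph; rewrite -?BE //; first exact: psd_congr.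
  rewrite /An /Bn /V trmxK.
  have cancel (W S A B : 'M[R]_(m + n)) : W *m S = 1%:M -> A *m B = 0 ->
      W^T *m A *m W *m (S *m B *m S^T) = 0.
    move=> WS AB'; rewrite -!mulmxA [W *m _]mulmxA WS mul1mx [A *m _]mulmxA AB'.
    by rewrite mul0mx mulmx0.
  by apply: cancel AB; rewrite mulVmx.
- split=> //; apply: (@bigO_le _ _ _ _ _ _ _ _ (fun i => (An i - At i) +
    (At i - dilA X0 Y0 - t i *: (dilA (X1 i) (Y1 i) - dilA X0 Y0)))); last exact: bigOD HAn CA.2.
  move=> i; apply: le_trans (mnorm_ursubmx _); rewrite addrA addrA subrK.
  rewrite ursubmx_residual /dilA !block_mxKur.
  rewrite [X in _ <= mnorm X](_ : _ = - (- ursubmx (An i) - X0 - t i *: (X1 i - X0))) ?mnormN //.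
  by apply/matrixP => j k; rewrite !mxE; ring.
- split=> //; apply: (@bigO_le _ _ _ _ _ _ _ _ (fun i => (Bn i - Bt i) +
    (Bt i - dilB Y0 - t i *: (dilB (Y1 i) - dilB Y0)))); last exact: bigOD HBn CB.2.
  move=> i; apply: le_trans (mnorm_ursubmx _); rewrite addrA addrA subrK.
  by rewrite ursubmx_residual /dilB !block_mxKur.
Qed.

(** * Normal cones *)

(** The index type is taken to be all pairs of a graph point and a time in [[0, 1]], so the
    constants hidden in [bigO] become uniform in both. *)
Lemma gph_tangent_curve (R : realType) (m n : nat) (X Y : 'M[R]_(m, n)) :
  gph_subdiff_nuclear R m n (X, Y) ->
  exists C d, [/\ 0 <= C, 0 < d & forall X1 Y1 t,
    gph_subdiff_nuclear R m n (X1, Y1) -> 0 <= t -> t <= 1 ->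
    mnorm (X1 - X) + mnorm (Y1 - Y) <= d ->
    exists Xt Yt, [/\ gph_subdiff_nuclear R m n (Xt, Yt),
      mnorm (Xt - X - t *: (X1 - X)) <= C * (t * (mnorm (X1 - X) + mnorm (Y1 - Y)) ^+ 2) &
      mnorm (Yt - Y - t *: (Y1 - Y)) <= C * (t * (mnorm (X1 - X) + mnorm (Y1 - Y)) ^+ 2)]].
Proof.
move=> gXY.
pose I := {p : ('M[R]_(m, n) * 'M[R]_(m, n)) * R |
  gph_subdiff_nuclear R m n p.1 /\ (0 <= p.2 /\ p.2 <= 1)}.
pose e (i : I) := mnorm ((sval i).1.1 - X) + mnorm ((sval i).1.2 - Y).
pose t (i : I) := (sval i).2.
have et : scales e t.
  by move=> [[p s] [/= gp [s0 s1]]]; rewrite /e /t /=; split=> //; rewrite addr_ge0 ?mnorm_ge0.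
have g1 (i : I) : gph_subdiff_nuclear R m n ((sval i).1.1, (sval i).1.2).
  by case: i => [[[X1 Y1] s] []].
have HX : bigO e e (fun i => (sval i).1.1 - X).
  by exists 1, 1; split=> // i _; rewrite mul1r lerDl mnorm_ge0.
have HY : bigO e e (fun i => (sval i).1.2 - Y).
  by exists 1, 1; split=> // i _; rewrite mul1r lerDr mnorm_ge0.
have [Xt [Yt [d [d0 gt [_ [C1 [d1 [C10 d10 CX]]]] [_ [C2 [d2 [C20 d20 CY]]]]]]]] :=
  dilation_curve et gXY g1 HX HY.
exists (C1 + C2), (Num.min d (Num.min d1 d2)); split; first exact: addr_ge0.
  by rewrite !lt_min d0 d10.
move=> X1 Y1 s gs s0 s1; rewrite !le_min => /and3P[ed ed1 ed2].
pose i : I := exist _ ((X1, Y1), s) (conj gs (conj s0 s1)).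
have te0 : 0 <= s * (mnorm (X1 - X) + mnorm (Y1 - Y)) ^+ 2 by rewrite mulr_ge0 ?sqr_ge0.
exists (Xt i), (Yt i); split; first exact: gt.
- by rewrite (le_trans (CX i ed1)) // ler_wpM2r // lerDl.
- by rewrite (le_trans (CY i ed2)) // ler_wpM2r // lerDr.
Qed.

(** * Comparison of the entrywise and inner product norms *)

Lemma trace_inner_le_mnorm (R : realType) (m n : nat) (A B : 'M[R]_(m, n)) :
  `|trace_inner A B| <= mnorm A * mnorm B.
Proof.
by rewrite /trace_inner (le_trans (mnorm_trace _)) // (le_trans (mnormM _ _)) // mnorm_tr.
Qed.

Lemma trace_innerDr (R : realType) (m n : nat) (A B C : 'M[R]_(m, n)) :
  trace_inner A (B + C) = trace_inner A B + trace_inner A C.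
Proof. by rewrite /trace_inner mulmxDr linearD. Qed.

Lemma trace_innerZr (R : realType) (m n : nat) (a : R) (A B : 'M[R]_(m, n)) :
  trace_inner A (a *: B) = a * trace_inner A B.
Proof. by rewrite /trace_inner -scalemxAr linearZ. Qed.

Lemma trace_inner_entry (R : realType) (m n : nat) (A : 'M[R]_(m, n)) i j :
  A i j ^+ 2 <= trace_inner A A.
Proof.
rewrite /trace_inner /mxtrace (bigD1 j) //= mxE (bigD1 i) //= mxE -expr2 -addrA lerDl addr_ge0
    ?sumr_ge0 // => k _.
  by rewrite mxE -expr2 sqr_ge0.
by rewrite mxE sumr_ge0 // => l _; rewrite mxE -expr2 sqr_ge0.
Qed.

Lemma trace_inner_ge0 (R : realType) (m n : nat) (A : 'M[R]_(m, n)) : 0 <= trace_inner A A.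
Proof.
rewrite /trace_inner sumr_ge0 // => k _.
by rewrite mxE sumr_ge0 // => l _; rewrite mxE -expr2 sqr_ge0.
Qed.

Lemma prod_norm_le_mnorm (R : realType) (m n : nat) (h : 'M[R]_(m, n) * 'M[R]_(m, n)) :
  inner_norm (prod_inner (@trace_inner R m n) (@trace_inner R m n)) h <= mnorm h.1 + mnorm h.2.
Proof.
have h1 := mnorm_ge0 h.1; have h2 := mnorm_ge0 h.2.
rewrite /inner_norm -[leRHS](ger0_norm (addr_ge0 h1 h2)) -sqrtr_sqr ler_wsqrtr //.
rewrite /prod_inner (@le_trans _ _ (mnorm h.1 * mnorm h.1 + mnorm h.2 * mnorm h.2)) //; last by nra.
by rewrite lerD // (le_trans (ler_norm _)) // trace_inner_le_mnorm.
Qed.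

Lemma mnorm_le_prod_norm (R : realType) (m n : nat) (h : 'M[R]_(m, n) * 'M[R]_(m, n)) :
  mnorm h.1 + mnorm h.2 <=
  ((m * n)%:R *+ 2) * inner_norm (prod_inner (@trace_inner R m n) (@trace_inner R m n)) h.
Proof.
set N := inner_norm _ _.
have le_mn (A : 'M[R]_(m, n)) :
    trace_inner A A <= prod_inner (@trace_inner R m n) (@trace_inner R m n) h h ->
    mnorm A <= (m * n)%:R * N.
  move=> AN; apply: (@le_trans _ _ (\sum_(i < m) \sum_(j < n) N)); last first.
    by rewrite !sumr_const !card_ord -mulrnA mulnC mulr_natl.
  apply: ler_sum => i _; apply: ler_sum => j _; rewrite -sqrtr_sqr ler_wsqrtr //.
  exact: le_trans (trace_inner_entry A i j) AN.
by rewrite mulr2n mulrDl lerD // le_mn // /prod_inner ?lerDl ?lerDr trace_inner_ge0.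
Qed.

Lemma proximal_sub_regular (R : realType) (V : zmodType) (ip : V -> V -> R) (S : set V) (x : V) :
  (proximal_normal_cone ip S x `<=` regular_normal_cone ip S x)%classic.
Proof.
(* Within distance [e / c], the bound [c |h|^2] is at most [e |h|]. *)
move=> v [c c0 prox] e e0; exists (e / c); first exact: divr_gt0.
move=> x' Sx'; rewrite ltr_pdivlMr // => near; rewrite (le_trans (prox x' Sx')) //.
by rewrite expr2 mulrA ler_wpM2r ?sqrtr_ge0 // mulrC ltW.
Qed.

Theorem proposition3p1 (R : realType) (m n : nat) (hmn : (m <= n)%N)
    (X Y : 'M[R]_(m, n)) (hXY : gph_subdiff_nuclear R m n (X, Y)) :
  regular_normal_cone (prod_inner (@trace_inner R m n) (@trace_inner R m n))
    (gph_subdiff_nuclear R m n) (X, Y) =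
  proximal_normal_cone (prod_inner (@trace_inner R m n) (@trace_inner R m n))
    (gph_subdiff_nuclear R m n) (X, Y).
Proof.
apply/seteqP; split; last exact: proximal_sub_regular.
move=> [v1 v2] reg.
have [C [d [C0 d0 curve]]] := gph_tangent_curve hXY.
pose V := mnorm v1 + mnorm v2.
have V0 : 0 <= V by rewrite addr_ge0 ?mnorm_ge0.
have ipV (h1 h2 : 'M[R]_(m, n)) :
    `|trace_inner v1 h1 + trace_inner v2 h2| <= V * (mnorm h1 + mnorm h2).
  rewrite (le_trans (ler_normD _ _)) //.
  have := trace_inner_le_mnorm v1 h1; have := trace_inner_le_mnorm v2 h2.
  have := mnorm_ge0 h1; have := mnorm_ge0 h2; have := mnorm_ge0 v1; have := mnorm_ge0 v2.
  rewrite /V; nra.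
(* The first summand serves points within [d], through the curve. Beyond [d], the linear bound [V N]
   is already at most [(V / d) N^2]. *)
pose E := 2 * V * C + V / d.
have E0 : 0 <= E by apply: addr_ge0; [rewrite !mulr_ge0|rewrite divr_ge0 // ltW].
suff bound X1 Y1 : gph_subdiff_nuclear R m n (X1, Y1) ->
    trace_inner v1 (X1 - X) + trace_inner v2 (Y1 - Y) <= E * (mnorm (X1 - X) + mnorm (Y1 - Y)) ^+ 2.
  (* The factor converts the entrywise norm into the product norm, and adding 1 makes the constant
     strictly positive. *)
  exists (E * ((m * n)%:R *+ 2) ^+ 2 + 1).
    by rewrite ltr_wpDl // mulr_ge0 ?sqr_ge0.
  move=> [X1 Y1] /bound; rewrite /prod_inner /= => /le_trans; apply.
  set N := inner_norm _ _.
  apply: (@le_trans _ _ (E * (((m * n)%:R *+ 2) * N) ^+ 2)); last first.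
    by move: (_ *+ 2) => K; have := sqr_ge0 N; lra.
  rewrite ler_wpM2l // ler_pXn2r // ?nnegrE ?addr_ge0 ?mnorm_ge0 //.
    exact: (mnorm_le_prod_norm (X1 - X, Y1 - Y)).
  by rewrite mulr_ge0 ?sqrtr_ge0 // mulrn_wge0.
move=> g1; set a := trace_inner v1 _ + _; set N := mnorm (X1 - X) + _.
have N0 : 0 <= N by rewrite addr_ge0 ?mnorm_ge0.
have aVN : a <= V * N by apply: le_trans (ipV _ _); apply: ler_norm.
have [Nd|/ltW dN] := leP N d; last first.
  apply: (le_trans aVN); rewrite /E expr2 mulrA ler_wpM2r // mulrDl.
  rewrite (le_trans (y := V / d * N)) ?lerDr ?mulr_ge0 //.
  by rewrite -mulrA ler_peMr // mulrC ler_pdivlMr // mul1r.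
suff aN : a <= 2 * V * C * N ^+ 2.
  by apply: (le_trans aN); rewrite ler_wpM2r ?sqr_ge0 // lerDl divr_ge0 // ltW.
apply/ler_addgt0Pr => r r0.
(* [t M] bounds the distance from the base point to the curve at time [t]: the chord contributes
   [t N] and the two errors [2 C t N^2]; the 1 ensures [M > 0]. Regularity is used with slope
   [r / M], so that its right-hand side is at most [t r]. *)
pose M := N + 2 * C * N ^+ 2 + 1.
have M0 : 0 < M by rewrite ltr_wpDl // addr_ge0 // !mulr_ge0 ?sqr_ge0.
have [dl dl0 regd] := reg (r / M) (divr_gt0 r0 M0).
(* The factor 2 makes [t M] strictly smaller than [dl]. *)
pose t := Num.min 1 (dl / (2 * M)).
have t0 : 0 < t by rewrite lt_min ltr01 divr_gt0 // mulr_gt0.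
have t1 : t <= 1 by rewrite ge_min lexx.
have tM : t * M < dl.
  have : t <= dl / (2 * M) by rewrite ge_min lexx orbT.
  rewrite ler_pdivlMr ?mulr_gt0 //; nra.
have [Xt [Yt [gt errX errY]]] := curve X1 Y1 t g1 (ltW t0) t1 Nd.
rewrite -/N in errX errY.
set rX := Xt - X - _ in errX; set rY := Yt - Y - _ in errY.
have XE : Xt - X = t *: (X1 - X) + rX by rewrite /rX [RHS]addrC subrK.
have YE : Yt - Y = t *: (Y1 - Y) + rY by rewrite /rY [RHS]addrC subrK.
clearbody rX rY.
have nt : inner_norm (prod_inner (@trace_inner R m n) (@trace_inner R m n)) ((Xt, Yt) - (X,
    Y)) <= t * M.
  apply: (le_trans (prod_norm_le_mnorm _)); rewrite /= XE YE.
  have := mnormD (t *: (X1 - X)) rX; have := mnormD (t *: (Y1 - Y)) rY.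
  rewrite !mnormZ (gtr0_norm t0) /M.
  have -> : t * (N + 2 * C * N ^+ 2 + 1) = t * mnorm (X1 - X) + t * mnorm (Y1 - Y) + 2 * (C * (t
      * N ^+ 2)) + t.
    by rewrite /N; ring.
  lra.
have := regd (Xt, Yt) gt (le_lt_trans nt tM).
move: nt; set W := inner_norm _ _ => nt.
rewrite /prod_inner /= XE YE !trace_innerDr !trace_innerZr => reg_t.
have reg_t' : t * a + (trace_inner v1 rX + trace_inner v2 rY) <= t * r.
  have -> : t * r = r / M * (t * M) by field; rewrite gt_eqF.
  have : r / M * W <= r / M * (t * M).
    by rewrite ler_wpM2l // divr_ge0 // ltW.
  move: reg_t; rewrite /a mulrDr; lra.
have errV : - (trace_inner v1 rX + trace_inner v2 rY) <= V * (2 * (C * (t * N ^+ 2))).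
  apply: (@le_trans _ _ `|trace_inner v1 rX + trace_inner v2 rY|);
      first by rewrite -normrN ler_norm.
  by rewrite (le_trans (ipV _ _)) // ler_wpM2l //; lra.
(* Both the regularity bound and the curve error carry a factor [t]; dividing by it leaves
   [a <= 2 V C N^2 + r]. *)
rewrite -(ler_pM2l t0).
have -> : t * (2 * V * C * N ^+ 2 + r) = V * (2 * (C * (t * N ^+ 2))) + t * r by ring.
lra.
Qed.
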